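(* ($q$-Krawtchouk.) Let $\overline x=x+\eta$ with $\eta\in\{0,+1,-1\}$ and $\overline{\boldsymbol\rho}=\overline\alpha,\overline N,q$. The whole list of non-trivial $A_2$-contiguity relations between $R_i(x;\boldsymbol\rho)=R^{(qK)}_i(x;\boldsymbol\rho)$ and $R_i(\overline x;\overline{\boldsymbol\rho})$ is the following (in each case both the relation and its associated relation hold, with the given coefficients, determined up to rescaling, and $\lambda^+_{x,\boldsymbol\rho}=1$): (qKI) $\eta=0$, $\overline\alpha=q\alpha$, $\overline N=N$: $\Phi_i^{0,+}=\frac{1-\alpha q^i}{1-\alpha q^{2i}}$, $\Phi_i^{-1,+}=\frac{\alpha q^i(1-q^i)}{1-\alpha q^{2i}}$, $\lambda^-_{x,\boldsymbol\rho}=q^{N-x}$, $\Phi_i^{0,-}=\frac{q^i(1-\alpha q^{N+i+1})}{1-\alpha q^{2i+1}}$, $\Phi_i^{1,-}=\frac{q^N-q^i}{1-\alpha q^{2i+1}}$. (qKII) $\eta=0$, $\overline\alpha=q\alpha$, $\overline N=N-1$: $\Phi_i^{0,+}=\frac{(1-q^{i-N})(1-\alpha q^i)}{(1-\alpha q^{2i})(1-q^{-N})}$, $\Phi_i^{-1,+}=\frac{(1-q^i)(1-\alpha q^{N+i})}{(1-\alpha q^{2i})(1-q^N)}$, $\lambda^-_{x,\boldsymbol\rho}=\frac{1-q^{N-x}}{1-q^N}$, $\Phi_i^{0,-}=-\frac{\alpha q^{2i+1}}{1-\alpha q^{2i+1}}$, $\Phi_i^{1,-}=\frac{1}{1-\alpha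 q^{2i+1}}$. (qKIII) $\eta=-1$, $\overline\alpha=q\alpha$, $\overline N=N-1$: $\Phi_i^{0,+}=\frac{(1-q^{N-i})(1-\alpha q^i)}{(1-\alpha q^{2i})(1-q^N)}$, $\Phi_i^{-1,+}=\alpha q^i\frac{(1-\alpha q^{i+N})(1-q^i)}{(1-\alpha q^{2i})(1-q^N)}$, $\lambda^-_{x,\boldsymbol\rho}=\frac{1-q^{-x}}{1-q^N}$, $\Phi_i^{0,-}=-\frac{q^{i-N}}{1-\alpha q^{2i+1}}$, $\Phi_i^{1,-}=\frac{q^{i-N}}{1-\alpha q^{2i+1}}$. Moreover, for $\overline N\in\{N,N-1,N+1,N-2,N+2\}$, all contiguity relations of type $B_2$ and all those of type $B'_2$ for the $q$-Krawtchouk polynomials are obtained by applying $A_2$-contiguity relations twice.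
   Context: $q$-Krawtchouk polynomials: for $\boldsymbol\rho=\alpha,N,q$, $N$ a non-negative integer, $i=0,\dots,N$, $$R^{(qK)}_i(x;\boldsymbol\rho)={}_3\phi_2\left({q^{-i},\ \alpha q^i,\ q^{-x}\atop q^{-N},\ 0}\Big|\,q;q\right),$$ where ${}_{p+1}\phi_p\big({q^{-i},a_1,\dots,a_p\atop b_1,\dots,b_p}|q;z\big)=\sum_{k=0}^i\frac{(q^{-i},a_1,\dots,a_p;q)_k}{(q,b_1,\dots,b_p;q)_k}z^k$, $(b_1,\dots,b_p;q)_k=\prod_j(b_j;q)_k$, $(b;q)_k=\prod_{\ell=0}^{k-1}(1-bq^\ell)$. $R_i$ has degree $i$ in $\lambda_{x,\boldsymbol\rho}=-(1-q^{-x})$. Conventions. Parameters are generic. $\overline{\boldsymbol\rho}$ denotes modified parameters; one requires $\lambda_{x,\boldsymbol\rho}=\zeta\lambda_{\overline x,\overline{\boldsymbol\rho}}-\xi$ with constants $\zeta,\xi$, here $\zeta=q^\eta$, $\xi=1-q^\eta$. An $A_2$-contiguity relation is $$\lambda^+_{x,\boldsymbol\rho}R_i(x;\boldsymbol\rho)=\Phi^{0,+}_iR_i(\overline x;\overline{\boldsymbol\rho})+\Phi^{-1,+}_iR_{i-1}(\overline x;\overline{\boldsymbol\rho}),\quad i\ge0,\ \Phi^{-1,+}_0=0,\ \Phi^{0,+}_0\ne0,$$ and its associated relation is $$\lambda^-_{x,\boldsymbol\rho}R_i(\overline x;\overline{\boldsymbol\rho})=\Phi^{1,-}_iR_{i+1}(x;\boldsymbol\rho)+\Phi^{0,-}_iR_i(x;\boldsymbol\rho),\quad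 i\ge0,$$ with $\lambda^\pm$ independent of $i$ and $\Phi$'s independent of $x$ (terms with zero coefficient are omitted at the boundary of the index range; for $i=0$ the expressions are taken as rational functions after cancellation). The trivial relation is $\eta=0$, $\overline{\boldsymbol\rho}=\boldsymbol\rho$. Contiguity relations of type $B_2$ (resp. $B'_2$) express $\lambda^+_{x,\boldsymbol\rho}R_i(x;\boldsymbol\rho)$ as a combination, with $x$-independent coefficients, of $R_{i+\epsilon}(\widetilde x;\widetilde{\boldsymbol\rho})$, $\epsilon\in\{1,0,-1\}$ (resp. $\epsilon\in\{0,-1,-2\}$); for these $\overline N$ denotes the integer parameter of the right-hand side polynomials. ''Applying $A_2$ relations twice'' means: for $B_2$, expand $R_i(x;\boldsymbol\rho)$ in $R_i,R_{i-1}$ at some $(\overline x,\overline{\boldsymbol\rho})$ by an $A_2$-contiguity relation and then expand these by the associated relation of an $A_2$-contiguity relation from $(\widetilde x,\widetilde{\boldsymbol\rho})$ to $(\overline x,\overline{\boldsymbol\rho})$; for $B'_2$, compose an $A_2$-contiguity relation from $(x,\boldsymbol\rho)$ to $(\overline x,\overline{\boldsymbol\rho})$ with one from $(\overline x,\overline{\boldsymbol\rho})$ to $(\widetilde x,\widetilde{\boldsymbol\rho})$.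
   Formalization: Completeness and the B_2, B'_2 claims are proved for N above some absolute bound (they fail e.g. at N=1), with N̄>0 in the A_2 list and zero relations excluded; B_2 relations with trivial target (recurrence with λ_x+c, c arbitrary) are linear combinations of two compositions. *)

(* Defs.v *)
From HB Require Import structures.
From mathcomp Require Import all_boot all_order all_algebra.

Set Implicit Arguments.
Unset Strict Implicit.
Unset Printing Implicit Defensive.

Import GRing.Theory.
Local Open Scope ring_scope.

Definition qpoch (F : fieldType) (q b : F) (k : nat) : F :=
  \prod_(l < k) (1 - b * q ^+ l).

(* The terminating series {p+1}_phi_p (q^-i, num; den | q; t). *)
Definition qhyp (F : fieldType) (q : F) (i : nat) (num den : seq F) (t : F) : F :=
  \sum_(k < i.+1)
    (\prod_(a <- q ^- i :: num) qpoch q a k)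
      / (\prod_(b <- q :: den) qpoch q b k) * t ^+ k.

(* The parameters (alpha, N); the base q is carried separately, since it is
   never modified. *)
Record qKparam (F : fieldType) := QKParam { qK_alpha : F; qK_N : nat }.

(* R_i(x; alpha, N, q), i <= N.  The variable x occurs only through q^-x, and
   the argument z stands for q^-x; hence q^-(x + eta) is q^(- eta) * z,
   lambda_x is z - 1, and q^(N - x) is q^N * z.  An identity "for all x" is one
   for all nonzero z. *)
Definition qKrawtchouk (F : fieldType) (q : F) (rho : qKparam F) (i : nat) (z : F) : F :=
  qhyp q i [:: qK_alpha rho * q ^+ i; z] [:: q ^- qK_N rho; 0] q.

(* Genericity.  The conditions on alpha give R_i degree exactly i in z and make
   all the denominators 1 - alpha q^m below nonzero. *)
Definition generic_base (F : fieldType) (q : F) : Prop :=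
  q != 0 /\ forall n : nat, (0 < n)%N -> q ^+ n != 1.

Definition generic_param (F : fieldType) (q : F) (rho : qKparam F) : Prop :=
  qK_alpha rho != 0 /\ forall m : int, qK_alpha rho != q ^ m.

Definition on_grid (F : fieldType) (q : F) (N : nat) (z : F) : Prop :=
  exists2 n : nat, (n <= N)%N & z = q ^- n.

Definition in_range (N : nat) (j : int) : bool := (0 <= j) && (j <= N%:Z).

(* lam_x R_i(x; rho) = \sum_(e in eps) Phi e i * R_(i+e)(x + eta; rho') for all
   i = 0, ..., N.  A term whose index i + e is not in {0, ..., N'} must have
   coefficient zero and is omitted.  The identity is required for all x, except
   when a term is omitted because i + e > N': the polynomials of degree > N'
   are only defined up to functions vanishing on the grid 0, ..., N', and the
   identity is then one on the grid (x in {0, ..., N} and x + eta in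
   {0, ..., N'}), just as the three-term recurrence relation at i = N. *)
Definition expansion (F : fieldType) (q : F) (rho rho' : qKparam F) (eta : int)
    (eps : seq int) (lam : F -> F) (Phi : int -> nat -> F) : Prop :=
  forall i : nat, (i <= qK_N rho)%N ->
    (forall e : int, e \in eps -> ~~ in_range (qK_N rho') (i%:Z + e) ->
       Phi e i = 0) /\
    (forall z : F, z != 0 ->
       (forall e : int, e \in eps -> i%:Z + e <= (qK_N rho')%:Z) \/
       (on_grid q (qK_N rho) z /\ on_grid q (qK_N rho') (q ^ (- eta) * z)) ->
       lam z * qKrawtchouk q rho i z =
         \sum_(e <- eps | in_range (qK_N rho') (i%:Z + e))
           Phi e i * qKrawtchouk q rho' `|(i%:Z + e)%R|%N (q ^ (- eta) * z)).

Definition A2_contiguity (F : fieldType) (q : F) (eta : int) (rho rhob : qKparam F)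
    (lamp : F -> F) (Phip : int -> nat -> F) : Prop :=
  expansion q rho rhob eta [:: 0; -1] lamp Phip /\ Phip 0 0%N != 0.

(* lamm is, as lamp, a function of z = q^-x, whereas the polynomials to be
   expanded are evaluated at xbar = x + eta. *)
Definition A2_associated (F : fieldType) (q : F) (eta : int) (rho rhob : qKparam F)
    (lamm : F -> F) (Phim : int -> nat -> F) : Prop :=
  expansion q rhob rho (- eta) [:: 1; 0] (fun zb => lamm (q ^ eta * zb)) Phim.

Definition A2_shift (eta : int) : bool := eta \in [:: 0; 1; -1].

Definition B2_contiguity (F : fieldType) (q : F) (eta : int) (rho rhot : qKparam F)
    (lam : F -> F) (Phi : int -> nat -> F) : Prop :=
  expansion q rho rhot eta [:: 1; 0; -1] lam Phi /\
  exists2 z : F, z != 0 & lam z != 0.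

Definition B2'_contiguity (F : fieldType) (q : F) (eta : int) (rho rhot : qKparam F)
    (lam : F -> F) (Phi : int -> nat -> F) : Prop :=
  expansion q rho rhot eta [:: 0; -1; -2] lam Phi /\
  exists2 z : F, z != 0 & lam z != 0.

(* (lam, Phi) results from an A2-contiguity relation from (x, rho) to
   (xbar, rhob), xbar = x + eta1, followed by the associated relation of an
   A2-contiguity relation from (xtilde, rhot) to (xbar, rhob),
   xbar = xtilde + eta2; so xtilde = x + eta with eta = eta1 - eta2. *)
Definition B2_from_A2 (F : fieldType) (q : F) (eta : int) (rho rhot : qKparam F)
    (lam : F -> F) (Phi : int -> nat -> F) : Prop :=
  exists (eta1 eta2 : int) (rhob : qKparam F)
         (lam1 lam2p lam2m : F -> F) (Phi1 Phi2p Phi2m : int -> nat -> F),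
    [/\ A2_shift eta1, A2_shift eta2, eta = eta1 - eta2 & generic_param q rhob] /\
    [/\ A2_contiguity q eta1 rho rhob lam1 Phi1,
        A2_contiguity q eta2 rhot rhob lam2p Phi2p &
        A2_associated q eta2 rhot rhob lam2m Phi2m] /\
    (forall z, z != 0 -> lam z = lam1 z * lam2m (q ^ (- eta) * z)) /\
    (forall i : nat, (i <= qK_N rho)%N ->
      [/\ Phi 1 i = Phi1 0 i * Phi2m 1 i,
          Phi 0 i = Phi1 0 i * Phi2m 0 i + Phi1 (-1) i * Phi2m 1 i.-1 &
          Phi (-1) i = Phi1 (-1) i * Phi2m 0 i.-1]).

(* The same for two A2-contiguity relations, from (x, rho) to (xbar, rhob) and
   from (xbar, rhob) to (xtilde, rhot). *)
Definition B2'_from_A2 (F : fieldType) (q : F) (eta : int) (rho rhot : qKparam F)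
    (lam : F -> F) (Phi : int -> nat -> F) : Prop :=
  exists (eta1 eta2 : int) (rhob : qKparam F)
         (lam1 lam2 : F -> F) (Phi1 Phi2 : int -> nat -> F),
    [/\ A2_shift eta1, A2_shift eta2, eta = eta1 + eta2 & generic_param q rhob] /\
    [/\ A2_contiguity q eta1 rho rhob lam1 Phi1 &
        A2_contiguity q eta2 rhob rhot lam2 Phi2] /\
    (forall z, z != 0 -> lam z = lam1 z * lam2 (q ^ (- eta1) * z)) /\
    (forall i : nat, (i <= qK_N rho)%N ->
      [/\ Phi 0 i = Phi1 0 i * Phi2 0 i,
          Phi (-1) i = Phi1 0 i * Phi2 (-1) i + Phi1 (-1) i * Phi2 0 i.-1 &
          Phi (-2) i = Phi1 (-1) i * Phi2 (-1) i.-1]).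

(* Equality of relations with i = 0, ..., N and offsets in eps. *)
Definition same_relation (F : fieldType) (N : nat) (eps : seq int)
    (lam lam' : F -> F) (Phi Phi' : int -> nat -> F) : Prop :=
  (forall z, z != 0 -> lam z = lam' z) /\
  (forall (e : int) (i : nat), e \in eps -> (i <= N)%N -> Phi e i = Phi' e i).

Inductive qK_case := qKI | qKII | qKIII.

Definition qK_eta (c : qK_case) : int :=
  match c with qKI => 0 | qKII => 0 | qKIII => -1 end.

(* The cases qKII and qKIII are only considered for N > 0. *)
Definition qK_bar (F : fieldType) (q : F) (c : qK_case) (rho : qKparam F) : qKparam F :=
  let: QKParam a N := rho in
  match c with
  | qKI => QKParam (q * a) N
  | qKII => QKParam (q * a) N.-1
  | qKIII => QKParam (q * a) N.-1
  end.

Definition qK_Phi0p (F : fieldType) (q : F) (c : qK_case) (rho : qKparam F) (i : nat) : F :=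
  let: QKParam a N := rho in
  match c with
  | qKI => (1 - a * q ^+ i) / (1 - a * q ^+ (2 * i))
  | qKII => (1 - q ^ (i%:Z - N%:Z)) * (1 - a * q ^+ i)
              / ((1 - a * q ^+ (2 * i)) * (1 - q ^- N))
  | qKIII => (1 - q ^ (N%:Z - i%:Z)) * (1 - a * q ^+ i)
              / ((1 - a * q ^+ (2 * i)) * (1 - q ^+ N))
  end.

Definition qK_Phi1p (F : fieldType) (q : F) (c : qK_case) (rho : qKparam F) (i : nat) : F :=
  let: QKParam a N := rho in
  match c with
  | qKI => a * q ^+ i * (1 - q ^+ i) / (1 - a * q ^+ (2 * i))
  | qKII => (1 - q ^+ i) * (1 - a * q ^+ (N + i))
              / ((1 - a * q ^+ (2 * i)) * (1 - q ^+ N))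
  | qKIII => a * q ^+ i *
              ((1 - a * q ^+ (i + N)) * (1 - q ^+ i)
                / ((1 - a * q ^+ (2 * i)) * (1 - q ^+ N)))
  end.

Definition qK_lamm (F : fieldType) (q : F) (c : qK_case) (rho : qKparam F) (z : F) : F :=
  let: QKParam a N := rho in
  match c with
  | qKI => q ^+ N * z
  | qKII => (1 - q ^+ N * z) / (1 - q ^+ N)
  | qKIII => (1 - z) / (1 - q ^+ N)
  end.

Definition qK_Phi0m (F : fieldType) (q : F) (c : qK_case) (rho : qKparam F) (i : nat) : F :=
  let: QKParam a N := rho in
  match c with
  | qKI => q ^+ i * (1 - a * q ^+ (N + i + 1)) / (1 - a * q ^+ (2 * i + 1))
  | qKII => - (a * q ^+ (2 * i + 1) / (1 - a * q ^+ (2 * i + 1)))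
  | qKIII => - (q ^ (i%:Z - N%:Z) / (1 - a * q ^+ (2 * i + 1)))
  end.

Definition qK_Phi1m (F : fieldType) (q : F) (c : qK_case) (rho : qKparam F) (i : nat) : F :=
  let: QKParam a N := rho in
  match c with
  | qKI => (q ^+ N - q ^+ i) / (1 - a * q ^+ (2 * i + 1))
  | qKII => 1 / (1 - a * q ^+ (2 * i + 1))
  | qKIII => q ^ (i%:Z - N%:Z) / (1 - a * q ^+ (2 * i + 1))
  end.

Definition qK_Phip (F : fieldType) (q : F) (c : qK_case) (rho : qKparam F)
    (e : int) (i : nat) : F :=
  if e == 0 then qK_Phi0p q c rho i else qK_Phi1p q c rho i.

Definition qK_Phim (F : fieldType) (q : F) (c : qK_case) (rho : qKparam F)
    (e : int) (i : nat) : F :=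
  if e == 0 then qK_Phi0m q c rho i else qK_Phi1m q c rho i.

(* Main.v *)
Require Import Defs.
From HB Require Import structures.
From mathcomp Require Import all_boot all_order all_algebra.
From mathcomp Require Import zify ring.

Set Implicit Arguments.
Unset Strict Implicit.
Unset Printing Implicit Defensive.

Import Order.TTheory GRing.Theory Num.Theory.
Local Open Scope ring_scope.

(** Why the classification holds.  For z = q^-x, the polynomials R_i(z; alpha, N)
    are orthogonal for the functional
      L g = sum_(0 <= x <= N) w(x) g(q^-x),   w(x) = (q^-N; q)_x / ((q; q)_x alpha^x)
    ([qKfun]; [qKfun_ortho_poly] for 2 i <= N).  The ratio w(x+1) / w(x) is rational in
    q^x, and this is the Pearson equation [qKfun_pearson]
      L[(q^-N - z) f(z)] = alpha q L[(1 - z) f(q z)]   for every function f.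

    Consider a relation lam(z) R_i(z; rho) = sum_e Phi e i R_(i+e)(z'; rho'), with
    z' = q^-eta z, and let L' be the functional of rho', read in the variable z.
    For the small indices i with 0 < i + e for every offset e, L' kills the right-hand
    side.  So the functional f |-> L'[lam f] kills R_i for all small i > d, with d = 1
    for type B_2 and d = 2 for type B'_2, and by orthogonality it is, on the f of
    low degree, f |-> L[p f] for a polynomial p of degree at most d
    ([functional_density]): informally lam w' = p w.
    Combining the Pearson equations of L and L' and using that L is regular gives an
    identity between polynomials ([weight_ratio]) which expresses that p / lam has the
    same q-shift quotient as w' / w.

    Only low degrees were used, so N enters this identity merely through the
    constants q^-N and q^-N'.  Comparing multiplicities of roots at q^m shows that
    p / lam vanishes on the points of the grid of rho that are not in the grid of rho',
    and has poles at the points of the grid of rho' that are not in the grid of rho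
    ([support_roots]).  As p and lam have degree at most 2 in total, the two grids
    differ in at most two points; this leaves finitely many (eta, N').  The lowest and
    the highest coefficients of the identity, or one of its values when p or lam is a
    multiple of z, then leave finitely many pairs of alpha' and, up to a factor, lam,
    unless eta = 0 and rho' = rho ([B2_classify], [B2'_classify]).  Each of the surviving cases is reached by
    composing two of the relations qKI, qKII, qKIII and the trivial one
    ([expansion_comp_up_down], [expansion_comp_up_up]).

    The coefficients of an expansion are determined by lam ([expansion_unique]).  This
    is linear independence of the R_i, except for the last indices i, where some i + e
    exceeds N': the identity then holds only on the common points of the two grids, which
    may miss one point x0 of the grid of rho'.  The sum f of the R_(i+e) concerned is orthogonal
    to 1, so w'(x0) f(x0) = L' f = 0, and f vanishes on the whole grid.

    An A_2-contiguity relation is a B_2 relation with a zero coefficient and a constant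
    multiplier lam, and its associated relation is a B_2 relation in the opposite
    direction, so both are covered by the classification of type B_2.  The six
    explicit relations are checked by comparing coefficients in the basis (z; q)_k, or
    (q z; q)_k for the contiguity relation qKIII. *)

(** * Powers of q, q-shifted factorials, and the coefficients of the polynomials *)
Section Base.
Variables (F : fieldType) (q : F).
Hypothesis hq : generic_base q.

Lemma q_neq0 : q != 0. Proof. by case: hq. Qed.

Lemma qX_neq0 n : q ^+ n != 0. Proof. exact: expf_neq0 q_neq0. Qed.

Lemma qXz_neq0 (m : int) : q ^ m != 0. Proof. exact: expfz_neq0 q_neq0. Qed.

Lemma qX_neq1 n : (0 < n)%N -> 1 - q ^+ n != 0.
Proof. by case: hq => _ h /h; rewrite subr_eq0 eq_sym. Qed.

Lemma qXz_eq1 (m : int) : (q ^ m == 1) = (m == 0).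
Proof.
apply/eqP/eqP => [|->]; last by rewrite expr0z.
case: m => [[|n]|n] // h.
  by have := @qX_neq1 n.+1 isT; rewrite -exprnP in h; rewrite h subrr eqxx.
have := @qX_neq1 n.+1 isT; rewrite NegzE -exprnN in h.
by move/(congr1 GRing.inv): h; rewrite invrK invr1 => ->; rewrite subrr eqxx.
Qed.

Lemma qXz_inj : injective (fun m : int => q ^ m).
Proof.
move=> m n h; apply/eqP; rewrite -subr_eq0 -qXz_eq1 expfzDr ?q_neq0 //.
by rewrite h -expfzDr ?q_neq0 // subrr expr0z.
Qed.

Lemma qX_inj : injective (fun n : nat => q ^+ n).
Proof. by move=> m n h; have := @qXz_inj m%:Z n%:Z; rewrite -!exprnP => /(_ h) []. Qed.

Lemma expz_subnn (i N : nat) : q ^ (i%:Z - N%:Z) = q ^+ i / q ^+ N.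
Proof. by rewrite expfzDr ?q_neq0 // -exprnP exprnN. Qed.

Lemma generic_alphaX (a : F) (N n : nat) : generic_param q (QKParam a N) -> 1 - a * q ^+ n != 0.
Proof.
case=> /= a0 /(_ (- n%:Z)); apply: contra; rewrite subr_eq0 => /eqP h.
by rewrite -exprnN; apply/eqP/(mulIf (qX_neq0 n)); rewrite -h mulVf ?qX_neq0.
Qed.

Lemma qpoch0 b : qpoch q b 0 = 1. Proof. by rewrite /qpoch big_ord0. Qed.

Lemma qpochS b k : qpoch q b k.+1 = qpoch q b k * (1 - b * q ^+ k).
Proof. by rewrite /qpoch big_ord_recr. Qed.

Lemma qpochSl b k : qpoch q b k.+1 = (1 - b) * qpoch q (b * q) k.
Proof.
rewrite /qpoch big_ord_recl expr0 mulr1; congr (_ * _).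
by apply: eq_bigr => j _; rewrite /= /bump /= add1n exprS mulrA.
Qed.

Lemma qpoch_zero k : qpoch q 0 k = 1.
Proof. by rewrite /qpoch big1 // => j _; rewrite mul0r subr0. Qed.

Lemma qpoch_gt b n k : b * q ^+ n = 1 -> (n < k)%N -> qpoch q b k = 0.
Proof.
move=> h lt_nk; rewrite /qpoch (bigD1 (Ordinal lt_nk)) //= h subrr mul0r //.
Qed.

Lemma qpoch_neq0 b k : (forall l, (l < k)%N -> b * q ^+ l != 1) -> qpoch q b k != 0.
Proof.
by move=> h; apply/prodf_neq0 => l _; rewrite subr_eq0 eq_sym h.
Qed.

Lemma qpochqq_neq0 k : qpoch q q k != 0.
Proof.
apply: qpoch_neq0 => l _; rewrite -exprS.
by case: hq => _ ->.
Qed.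

Lemma qpochqN_neq0 N k : (k <= N)%N -> qpoch q (q ^- N) k != 0.
Proof.
move=> lekN; apply: qpoch_neq0 => l ltlk; rewrite mulrC -expz_subnn qXz_eq1; lia.
Qed.

Lemma qpochqN_eq0 N k : (N < k)%N -> qpoch q (q ^- N) k = 0.
Proof. by move=> ltNk; apply: qpoch_gt ltNk; rewrite mulVf ?qX_neq0. Qed.

(** The numerator (q^-i; q)_k (a q^i; q)_k of the k-th coefficient of R_i. *)
Definition qKnum a i k := qpoch q (q ^- i) k * qpoch q (a * q ^+ i) k.

(** The coefficient of (z; q)_k in R_i(z; a, N). *)
Definition qKcoef a N i k :=
  qKnum a i k / (qpoch q q k * qpoch q (q ^- N) k) * q ^+ k.

Lemma qKcoef_gt a N i k : (i < k)%N -> qKcoef a N i k = 0.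
Proof. by move=> ltik; rewrite /qKcoef /qKnum qpochqN_eq0 // !mul0r. Qed.

Lemma qKcoef0 a N i : qKcoef a N i 0 = 1.
Proof. by rewrite /qKcoef /qKnum !qpoch0 expr0 !mulr1 divr1. Qed.

Lemma qKrawtchoukE a N i n z : (i < n)%N ->
  qKrawtchouk q (QKParam a N) i z = \sum_(k < n) qKcoef a N i k * qpoch q z k.
Proof.
move=> ltin; rewrite /qKrawtchouk /qhyp /=.
set G := fun k => (\prod_(c <- [:: q ^- i; a * q ^+ i; z]) qpoch q c k)
  / (\prod_(b <- [:: q; q ^- N; 0]) qpoch q b k) * q ^+ k.
rewrite -[LHS]/(\sum_(k < i.+1) G k).
rewrite (big_ord_widen n G ltin) big_mkcond; apply: eq_bigr => k _.
case: ltnP => [_|ltik]; last by rewrite qKcoef_gt ?mul0r.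
rewrite /G !big_cons !big_nil qpoch_zero /qKcoef /qKnum /= !mulr1.
by rewrite mulrA -!mulrA; do 2 congr (_ * _); rewrite mulrCA; congr (_ * _); rewrite mulrC.
Qed.

End Base.

(** * The six relations, coefficient by coefficient *)
(** [field], with the conjunction of side conditions split. *)
Ltac fld := field; do ?[apply/andP; split].

Section Relations.
Variables (F : fieldType) (q : F).
Hypothesis hq : generic_base q.
Variable a : F.

(** The three numerators that occur in a contiguity relation, as multiples of a
    common factor. *)
Lemma qKnum_plus i k :
  let X := qpoch q (q ^- i) k * qpoch q (a * q ^+ i.+2) k in
  [/\ qKnum q a i.+1 k.+1 = (1 - q ^- i.+1) * (1 - a * q ^+ i.+1) * X,
      qKnum q (q * a) i.+1 k.+1 = (1 - q ^- i.+1) * (1 - a * q ^+ i.+2 * q ^+ k) * X &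
      qKnum q (q * a) i k.+1 = (1 - q ^+ k / q ^+ i) * (1 - a * q ^+ i.+1) * X].
Proof.
have e1 : q ^- i.+1 * q = q ^- i by rewrite exprSr invfM -mulrA mulVf ?mulr1 ?(q_neq0 hq).
have e2 : a * q ^+ i.+1 * q = a * q ^+ i.+2 by rewrite -mulrA -exprSr.
have e3 j : q * a * q ^+ j = a * q ^+ j.+1 by rewrite exprS; ring.
move=> X; split; rewrite /qKnum ?e3.
- by rewrite !qpochSl e1 e2 /X; ring.
- by rewrite qpochSl e1 qpochS /X; ring.
- by rewrite qpochS qpochSl e2 /X; ring.
Qed.

(** The four numerators that occur in an associated relation, as multiples of a
    common factor. *)
Lemma qKnum_minus i k :
  let Y := qpoch q (q ^- i) k * qpoch q (a * q ^+ i.+1) k in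
  [/\ qKnum q a i.+1 k.+1 = (1 - q ^- i.+1) * (1 - a * q ^+ i.+1 * q ^+ k) * Y,
      qKnum q a i k.+1 = (1 - q ^+ k / q ^+ i) * (1 - a * q ^+ i) * Y,
      qKnum q (q * a) i k = Y &
      qKnum q (q * a) i k.+1 = (1 - q ^+ k / q ^+ i) * (1 - a * q ^+ i.+1 * q ^+ k) * Y].
Proof.
have e1 : q ^- i.+1 * q = q ^- i by rewrite exprSr invfM -mulrA mulVf ?mulr1 ?(q_neq0 hq).
have e2 : a * q ^+ i * q = a * q ^+ i.+1 by rewrite -mulrA -exprSr.
have e3 j : q * a * q ^+ j = a * q ^+ j.+1 by rewrite exprS; ring.
move=> Y; split; rewrite /qKnum ?e3 //.
- by rewrite qpochSl e1 qpochS /Y; ring.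
- by rewrite qpochS qpochSl e2 /Y; ring.
- by rewrite !qpochS /Y; ring.
Qed.

Variable N : nat.
Hypothesis ha : generic_param q (QKParam a N).

Let q0 := q_neq0 hq.
Let qX0 n : q ^+ n != 0 := qX_neq0 hq n.
Let qX1 n : (0 < n)%N -> 1 - q ^+ n != 0 := @qX_neq1 _ _ hq n.
Let aX1 n : 1 - a * q ^+ n != 0 := generic_alphaX hq n ha.

Local Notation K := (qKrawtchouk q).
Local Notation P c e i := (qK_Phip q c (QKParam a N) e i).
Local Notation Pm c e i := (qK_Phim q c (QKParam a N) e i).

Lemma comb2_mulr (A B c c1 c2 f : F) :
  c = A * c1 + B * c2 -> c * f = A * (c1 * f) + B * (c2 * f).
Proof. by move->; ring. Qed.

(** Each contiguity relation is an identity between the coefficients of (z; q)_k,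
    or of (q z; q)_k for qKIII. *)
Lemma qKI_coefp i k : (k <= N)%N ->
  qKcoef q a N i.+1 k = P qKI 0 i.+1 * qKcoef q (q * a) N i.+1 k
                      + P qKI (-1) i.+1 * qKcoef q (q * a) N i k.
Proof.
move=> lekN; rewrite /qK_Phip /=.
have D1 : 1 - a * (q ^+ i.+1 * q ^+ i.+1) != 0 by rewrite -exprD aX1.
rewrite mul2n -addnn !exprD.
case: k lekN => [|k] lekN.
  by rewrite !qKcoef0; field.
rewrite /qKcoef; have [-> -> ->] := qKnum_plus i k.
have D2 := qpochqq_neq0 hq k.+1.
have D3 := qpochqN_neq0 hq lekN.
set X := _ * qpoch q _ _; move: D1 D2 D3; move: (qpoch q q _) (qpoch q (q ^- N) _) X.
rewrite !exprS.
have := qX0 i; move: (q ^+ i) (q ^+ k) => u v u0 b c X D1 D2 D3.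
by fld.
Qed.

Lemma qpochqN_pred k : (0 < N)%N ->
  qpoch q (q ^- N.-1) k = (1 - q ^+ k / q ^+ N) / (1 - q ^- N) * qpoch q (q ^- N) k.
Proof.
case: N => // M _; rewrite [_.+1.-1]/=; apply: (mulIf (x := 1 - q ^- M.+1)).
  by have := qX1 (ltn0Sn M); apply: contra; rewrite !subr_eq0 eq_sym invr_eq1 eq_sym.
have e1 : q ^- M.+1 * q = q ^- M by rewrite exprSr invfM -mulrA mulVf ?mulr1.
have D : 1 - q ^- M.+1 != 0.
  by have := qX1 (ltn0Sn M); apply: contra; rewrite !subr_eq0 eq_sym invr_eq1 eq_sym.
rewrite mulrC -e1 -qpochSl qpochS mulrAC divfK //; ring.
Qed.


Let vN : (0 < N)%N -> q ^+ N - 1 != 0.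
Proof. by move=> N0; rewrite -opprB oppr_eq0 qX1. Qed.

Let vNk k : (k < N)%N -> q ^+ N - q ^+ k != 0.
Proof. by move=> lt; rewrite subr_eq0 (inj_eq (qX_inj hq)) gtn_eqF. Qed.

Lemma qKII_coefp i k : (k < N)%N ->
  qKcoef q a N i.+1 k = P qKII 0 i.+1 * qKcoef q (q * a) N.-1 i.+1 k
                      + P qKII (-1) i.+1 * qKcoef q (q * a) N.-1 i k.
Proof.
move=> ltkN; rewrite /qK_Phip /= expz_subnn //.
have D1 : 1 - a * (q ^+ i.+1 * q ^+ i.+1) != 0 by rewrite -exprD aX1.
have D4 := vN (leq_ltn_trans (leq0n k) ltkN).
have D5 := qX1 (leq_ltn_trans (leq0n k) ltkN).
have D6 := qX0 N.
rewrite mul2n -addnn !exprD.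
case: k ltkN => [|k] ltkN.
  by rewrite !qKcoef0; fld.
have D7 := vNk ltkN.
rewrite /qKcoef qpochqN_pred; last by lia.
have [-> -> ->] := qKnum_plus i k.
have D2 := qpochqq_neq0 hq k.+1.
have D3 := qpochqN_neq0 hq (ltnW ltkN).
set X := _ * qpoch q _ _; move: D1 D2 D3 D4 D5 D6 D7.
move: (qpoch q q _) (qpoch q (q ^- N) _) X.
rewrite !exprS.
have := qX0 i; move: (q ^+ i) (q ^+ k) (q ^+ N) => u v w u0 b c X D1 D2 D3 D4 D5 D6 D7.
by fld.
Qed.

Lemma qKIII_coefp i k : (k < N)%N ->
  qKcoef q a N i.+1 k / q ^+ k + qKcoef q a N i.+1 k.+1 * (1 - q ^- k.+1)
  = P qKIII 0 i.+1 * qKcoef q (q * a) N.-1 i.+1 k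
    + P qKIII (-1) i.+1 * qKcoef q (q * a) N.-1 i k.
Proof.
move=> ltkN; rewrite /qK_Phip /= expz_subnn //.
have D1 : 1 - a * (q ^+ i.+1 * q ^+ i.+1) != 0 by rewrite -exprD aX1.
have D4 := vN (leq_ltn_trans (leq0n k) ltkN).
have D5 := qX1 (leq_ltn_trans (leq0n k) ltkN).
have D6 := qX0 N.
rewrite mul2n -addnn !exprD.
case: k ltkN => [|k] ltkN.
  rewrite !qKcoef0 /qKcoef /qKnum !qpochS !qpoch0 !expr0 !exprS expr0 !mulr1.
  have D7 := qX1 (ltn0Sn 0); move: D1 D4 D5 D6 D7 (qX0 i); rewrite expr1 !exprS.
  move: (q ^+ i) (q ^+ N) => u w D1 D4 D5 D6 D7 u0.
  by fld; rewrite ?oner_neq0.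
have D7 := vNk ltkN.
rewrite /qKcoef qpochqN_pred; last by lia.
have -> : qKnum q a i.+1 k.+2 =
  (1 - q ^+ k / q ^+ i) * (1 - a * q ^+ i.+1 * q ^+ k.+1) * qKnum q a i.+1 k.+1.
  rewrite /qKnum ![qpoch q _ k.+2]qpochS.
  have -> : q ^- i.+1 * q ^+ k.+1 = q ^+ k / q ^+ i.
    by rewrite !exprS invfM mulrC mulrACA divff // mul1r.
  ring.
rewrite ![qpoch q _ k.+2]qpochS.
have [-> -> ->] := qKnum_plus i k.
have D2 := qpochqq_neq0 hq k.+1.
have D8 := qX1 (ltn0Sn k.+1).
have D3 := qpochqN_neq0 hq (ltnW ltkN).
set X := _ * qpoch q _ _; move: D1 D2 D3 D4 D5 D6 D7 D8.
move: (qpoch q q _) (qpoch q (q ^- N) _) X.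
rewrite !exprS.
have := qX0 k; have := qX0 i.
move: (q ^+ i) (q ^+ k) (q ^+ N) => u v w u0 v0 b c X D1 D2 D3 D4 D5 D6 D7 D8.
by fld.
Qed.

(** Each associated relation is an identity between the coefficients of (z; q)_k;
    the constant coefficient is treated apart. *)
Lemma qKI_coefm0 i : q ^+ N = Pm qKI 1 i + Pm qKI 0 i.
Proof.
rewrite /qK_Phim /= !addn1.
have D1 : 1 - a * (q * (q ^+ i * q ^+ i)) != 0 by rewrite -exprD -exprS aX1.
rewrite mul2n -addnn !exprS !exprD; by fld.
Qed.

Lemma qKI_coefm i k : (k < N)%N ->
  q ^+ N * (qKcoef q (q * a) N i k.+1 / q ^+ k.+1 - qKcoef q (q * a) N i k / q ^+ k)
  = Pm qKI 1 i * qKcoef q a N i.+1 k.+1 + Pm qKI 0 i * qKcoef q a N i k.+1.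
Proof.
move=> ltkN; rewrite /qK_Phim /= !addn1.
have D1 : 1 - a * (q * (q ^+ i * q ^+ i)) != 0 by rewrite -exprD -exprS aX1.
have D3 := qpochqN_neq0 hq (ltnW ltkN).
have D2 := qpochqq_neq0 hq k.
have D7 := vNk ltkN.
have D8 := qX1 (ltn0Sn k).
rewrite mul2n -addnn /qKcoef; have [-> -> -> ->] := qKnum_minus i k.
rewrite ![qpoch q _ k.+1]qpochS.
set X := _ * qpoch q _ _; move: D1 D2 D3 D7 D8 (qX0 i) (qX0 k) (qX0 N).
move: (qpoch q q _) (qpoch q (q ^- N) _) X.
rewrite !exprS !exprD; move: (q ^+ i) (q ^+ k) (q ^+ N) => u v w b c X D1 D2 D3 D7 D8 u0 v0 w0.
by fld.
Qed.

Lemma qKII_coefm0 i : 1 = Pm qKII 1 i + Pm qKII 0 i.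
Proof.
rewrite /qK_Phim /= !addn1.
have D1 : 1 - a * q ^+ (2 * i).+1 != 0 by exact: aX1.
by field.
Qed.

Lemma qKII_coefm i k : (k < N)%N -> (i < N)%N ->
  (1 - q ^+ N)^-1 * (qKcoef q (q * a) N.-1 i k.+1 * (1 - q ^+ N / q ^+ k.+1)
                     + q ^+ N * qKcoef q (q * a) N.-1 i k / q ^+ k)
  = Pm qKII 1 i * qKcoef q a N i.+1 k.+1 + Pm qKII 0 i * qKcoef q a N i k.+1.
Proof.
move=> ltkN ltiN; rewrite /qK_Phim /= !addn1.
have D1 : 1 - a * (q * (q ^+ i * q ^+ i)) != 0 by rewrite -exprD -exprS aX1.
have D3 := qpochqN_neq0 hq (ltnW ltkN).
have D2 := qpochqq_neq0 hq k.
have D4 := vN (leq_ltn_trans (leq0n k) ltkN).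
have D5 := qX1 (leq_ltn_trans (leq0n k) ltkN).
have D7 := vNk ltkN.
have D8 := qX1 (ltn0Sn k).
have -> : qKcoef q (q * a) N.-1 i k.+1 * (1 - q ^+ N / q ^+ k.+1)
  = qKnum q (q * a) i k.+1 * q ^+ k.+1 * (1 - q ^- N) * (- (q ^+ N / q ^+ k.+1)) / (qpoch q q
    k.+1 * qpoch q (q ^- N) k.+1).
  move: (ltkN); rewrite leq_eqVlt => /predU1P [eqkN|ltk1].
    by rewrite eqkN divff // subrr mulr0 /qKnum qpochqN_eq0 ?eqkN ?mul0r.
  have D9 := vNk ltk1; rewrite /qKcoef qpochqN_pred; last by lia.
  have D10 := qpochqN_neq0 hq ltkN; have D11 := qpochqq_neq0 hq k.+1.
  move: D9 D10 D11 D4 (qX0 k.+1) (qX0 N); move: (qpoch q q _) (qpoch q (q ^- N) _) (qKnum _ _ _ _).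
  by move: (q ^+ k.+1) (q ^+ N) => u w b c X D9 D10 D11 D12 u0 w0; fld.
rewrite mul2n -addnn /qKcoef; have [-> -> -> ->] := qKnum_minus i k.
rewrite qpochqN_pred; last by lia.
rewrite ![qpoch q _ k.+1]qpochS.
set X := _ * qpoch q _ _; move: D1 D2 D3 D4 D5 D7 D8 (qX0 i) (qX0 k) (qX0 N).
move: (qpoch q q _) (qpoch q (q ^- N) _) X.
rewrite !exprS !exprD; move: (q ^+ i) (q ^+ k) (q ^+ N) => u v w b c X D1 D2 D3 D4 D5 D7 D8 u0 v0
  w0.
by fld.
Qed.

Lemma qKIII_coefm0 i : 0 = Pm qKIII 1 i + Pm qKIII 0 i.
Proof. by rewrite /qK_Phim /= addrC addNr. Qed.

Lemma qKIII_coefm i k : (k < N)%N ->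
  (1 - q ^+ N)^-1 * qKcoef q (q * a) N.-1 i k
  = Pm qKIII 1 i * qKcoef q a N i.+1 k.+1 + Pm qKIII 0 i * qKcoef q a N i k.+1.
Proof.
move=> ltkN; rewrite /qK_Phim /= !addn1 expz_subnn //.
have D1 : 1 - a * (q * (q ^+ i * q ^+ i)) != 0 by rewrite -exprD -exprS aX1.
have D3 := qpochqN_neq0 hq (ltnW ltkN).
have D2 := qpochqq_neq0 hq k.
have D4 := vN (leq_ltn_trans (leq0n k) ltkN).
have D5 := qX1 (leq_ltn_trans (leq0n k) ltkN).
have D7 := vNk ltkN.
have D8 := qX1 (ltn0Sn k).
rewrite mul2n -addnn /qKcoef; have [-> -> -> _] := qKnum_minus i k.
rewrite qpochqN_pred; last by lia.
rewrite ![qpoch q _ k.+1]qpochS.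
set X := _ * qpoch q _ _; move: D1 D2 D3 D4 D5 D7 D8 (qX0 i) (qX0 k) (qX0 N).
move: (qpoch q q _) (qpoch q (q ^- N) _) X.
rewrite !exprS !exprD; move: (q ^+ i) (q ^+ k) (q ^+ N) => u v w b c X D1 D2 D3 D4 D5 D7 D8 u0 v0
  w0.
by fld.
Qed.

Lemma qKrawtchouk0 (rho : qKparam F) z : K rho 0 z = 1.
Proof. by case: rho => b M; rewrite (@qKrawtchoukE _ _ hq _ _ _ 1) // big_ord1 qKcoef0 // qpoch0
  mulr1. Qed.

Lemma qK_Phip00 c : ((c <> qKI) -> (0 < N)%N) -> P c 0 0%N = 1.
Proof.
rewrite /qK_Phip /=; case: c => hN /=; rewrite ?expz_subnn // ?muln0 ?expr0 ?mulr1.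
- by rewrite divff ?(aX1 0) // -[a]mulr1 -(expr0 q) aX1.
- have D1 : 1 - a != 0 by have := aX1 0; rewrite expr0 mulr1.
  have D2 := vN (hN ltac:(done)); move: D2 (qX0 N); move: (q ^+ N) => w D2 w0.
  by fld.
- have D1 : 1 - a != 0 by have := aX1 0; rewrite expr0 mulr1.
  have D2 := qX1 (hN ltac:(done)); move: D2 (qX0 N); move: (q ^+ N) => w D2 w0.
  by rewrite divr1; fld.
Qed.

Lemma qKI_plus i z : (i < N)%N ->
  K (QKParam a N) i.+1 z = P qKI 0 i.+1 * K (QKParam (q * a) N) i.+1 z
                        + P qKI (-1) i.+1 * K (QKParam (q * a) N) i z.
Proof.
move=> ltiN; rewrite !(@qKrawtchoukE _ _ hq _ _ _ i.+2) // !mulr_sumr -big_split /=.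
apply: eq_bigr => [[k ltk]] _ /=; apply/comb2_mulr/qKI_coefp; lia.
Qed.

Lemma qKII_plus i z : (i.+1 < N)%N ->
  K (QKParam a N) i.+1 z = P qKII 0 i.+1 * K (QKParam (q * a) N.-1) i.+1 z
                        + P qKII (-1) i.+1 * K (QKParam (q * a) N.-1) i z.
Proof.
move=> ltiN; rewrite !(@qKrawtchoukE _ _ hq _ _ _ i.+2) // !mulr_sumr -big_split /=.
apply: eq_bigr => [[k ltk]] _ /=; apply/comb2_mulr/qKII_coefp; lia.
Qed.

Lemma qK_Phip0N c : c <> qKI -> (0 < N)%N -> P c 0 N = 0.
Proof.
by rewrite /qK_Phip; case: c => //= _ N0; rewrite subrr expr0z subrr !mul0r.
Qed.

(** For i = N the term R_N of the right-hand side has coefficient zero and does not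
    exist, and the identity holds on the grid of the right-hand side. *)
Lemma qKII_plusN n : (n < N)%N ->
  K (QKParam a N) N (q ^- n) = P qKII (-1) N * K (QKParam (q * a) N.-1) N.-1 (q ^- n).
Proof.
move=> ltnN; rewrite (@qKrawtchoukE _ _ hq _ _ _ N.+1) // (@qKrawtchoukE _ _ hq _ _ _ N);
  last by lia.
rewrite big_ord_recr /= (qpochqN_eq0 hq) // mulr0 addr0 mulr_sumr; apply: eq_bigr => [[k ltk]] _ /=.
have [i eN] : exists i, N = i.+1 by exists N.-1; lia.
have := qKII_coefp i ltk; rewrite -eN qK_Phip0N ?mul0r ?add0r => //; last by lia.
by move=> ->; rewrite eN /= mulrA.
Qed.

(** Expansion of (z; q)_(k+1) in the basis (q z; q)_k, in which the right-hand side
    of qKIII is expressed. *)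
Lemma qpochM k z : qpoch q z k.+1 =
  (1 - q ^- k.+1) * qpoch q (q * z) k + q ^- k.+1 * qpoch q (q * z) k.+1.
Proof.
rewrite qpochSl [qpoch q (q * z) k.+1]qpochS mulrC -[z * q]mulrC.
have := qX0 k.+1; rewrite !exprS; move: (q ^+ k) (qpoch _ _ _) => u c u0; field.
by move: u0; rewrite mulf_eq0 negb_or => /andP [-> ->].
Qed.

Lemma sum_qpochM (c : nat -> F) n z :
  \sum_(k < n.+1) c k * qpoch q z k =
  \sum_(k < n) (c k / q ^+ k + c k.+1 * (1 - q ^- k.+1)) * qpoch q (q * z) k
  + c n / q ^+ n * qpoch q (q * z) n.
Proof.
elim: n => [|n IH]; first by rewrite big_ord0 big_ord1 !qpoch0 expr0 divr1 add0r.
by rewrite big_ord_recr /= IH [in RHS]big_ord_recr /= qpochM; ring.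
Qed.

Lemma qKIII_plus i z : (i.+1 < N)%N ->
  K (QKParam a N) i.+1 z = P qKIII 0 i.+1 * K (QKParam (q * a) N.-1) i.+1 (q * z)
                        + P qKIII (-1) i.+1 * K (QKParam (q * a) N.-1) i (q * z).
Proof.
move=> ltiN; rewrite (@qKrawtchoukE _ _ hq _ _ _ i.+3); last by lia.
rewrite !(@qKrawtchoukE _ _ hq _ _ _ i.+2) // sum_qpochM qKcoef_gt // !mul0r addr0.
rewrite !mulr_sumr -big_split /=.
apply: eq_bigr => [[k ltk]] _ /=; apply/comb2_mulr/qKIII_coefp; lia.
Qed.

Lemma qKIII_plusN n z : (n < N)%N -> q * z = q ^- n ->
  K (QKParam a N) N z = P qKIII (-1) N * K (QKParam (q * a) N.-1) N.-1 (q ^- n).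
Proof.
move=> ltnN ez; rewrite (@qKrawtchoukE _ _ hq _ _ _ N.+1) // (@qKrawtchoukE _ _ hq _ _ _ N);
  last by lia.
rewrite sum_qpochM ez (qpochqN_eq0 hq) // mulr0 addr0 mulr_sumr; apply: eq_bigr => [[k ltk]] _ /=.
have [i eN] : exists i, N = i.+1 by exists N.-1; lia.
have := qKIII_coefp i ltk; rewrite -eN qK_Phip0N ?mul0r ?add0r => //; last by lia.
by move=> ->; rewrite eN /= mulrA.
Qed.

Lemma qpoch_mulz k z : z * qpoch q z k = (qpoch q z k - qpoch q z k.+1) / q ^+ k.
Proof. by rewrite qpochS; have := qX0 k; move: (q ^+ k) => u u0; field. Qed.

Lemma sum_qpoch_mulz (c : nat -> F) n z :
  z * (\sum_(k < n.+1) c k * qpoch q z k) =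
  c 0%N + \sum_(k < n) (c k.+1 / q ^+ k.+1 - c k / q ^+ k) * qpoch q z k.+1
  - c n / q ^+ n * qpoch q z n.+1.
Proof.
elim: n => [|n IH].
  by rewrite big_ord1 big_ord0 addr0 mulrCA qpoch_mulz qpoch0 expr0 !divr1; ring.
rewrite big_ord_recr mulrDr /= IH [in RHS]big_ord_recr /= mulrCA qpoch_mulz.
ring.
Qed.

Lemma sum_qpochS (c : nat -> F) n z :
  \sum_(k < n.+1) c k * qpoch q z k = c 0%N + \sum_(k < n) c k.+1 * qpoch q z k.+1.
Proof. by rewrite big_ord_recl qpoch0 mulr1. Qed.

Lemma qKI_minus i z : (i <= N)%N -> (i < N)%N \/ on_grid q N z ->
  q ^+ N * z * K (QKParam (q * a) N) i z
  = (if (i < N)%N then Pm qKI 1 i * K (QKParam a N) i.+1 z else 0) + Pm qKI 0 i * K (QKParam a N)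
    i z.
Proof.
move=> leiN hz; pose m := if (i < N)%N then i.+1 else N.
have ltim : (i < m.+1)%N by rewrite /m; case: (ltnP i N) => ?; lia.
have lemN : (m <= N)%N by rewrite /m; case: (ltnP i N) => ?; lia.
have -> : (if (i < N)%N then Pm qKI 1 i * K (QKParam a N) i.+1 z else 0) =
   Pm qKI 1 i * \sum_(k < m.+1) qKcoef q a N i.+1 k * qpoch q z k.
  rewrite /m; case: ltnP => [ltiN | leNi]; first by rewrite (@qKrawtchoukE _ _ hq _ _ _ i.+2).
  have -> : i = N by lia.
  by rewrite /qK_Phim /= subrr !mul0r.
rewrite !(@qKrawtchoukE _ _ hq _ _ _ m.+1) // -mulrA sum_qpoch_mulz.
have -> : qKcoef q (q * a) N i m / q ^+ m * qpoch q z m.+1 = 0.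
  case: (ltnP i N) => [ltiN | leNi]; first by rewrite /m ltiN qKcoef_gt ?mul0r.
  case: hz => [|[n len ->]]; first by lia.
  by rewrite [qpoch _ _ _](qpochqN_eq0 hq) ?mulr0 // /m ifF; lia.
rewrite subr0 qKcoef0 // mulrDr mulr1 [X in X + _](qKI_coefm0 i) mulr_sumr.
rewrite !big_ord_recl /= !qKcoef0 // qpoch0 !mulr1 !mulrDr !mulr1 addrACA; congr (_ + _).
rewrite !mulr_sumr -big_split; apply: eq_bigr => [[k ltk]] _ /=.
by rewrite mulrA /bump add1n; apply: comb2_mulr; apply: qKI_coefm; lia.
Qed.

Lemma qKII_minus i z : (i < N)%N ->
  (1 - q ^+ N * z) / (1 - q ^+ N) * K (QKParam (q * a) N.-1) i z
  = Pm qKII 1 i * K (QKParam a N) i.+1 z + Pm qKII 0 i * K (QKParam a N) i z.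
Proof.
move=> ltiN; rewrite !(@qKrawtchoukE _ _ hq _ _ _ i.+2) //.
rewrite [_ / _]mulrC -mulrA mulrBl mul1r -mulrA sum_qpoch_mulz.
rewrite [X in _ - X * qpoch q z _](_ : _ = 0) ?mul0r ?subr0; last first.
  by rewrite qKcoef_gt ?mul0r.
rewrite !sum_qpochS !qKcoef0 //.
set S1 := \sum_(k < _) _; set S2 := \sum_(k < _) (_ - _) * _.
have D := qX1 (leq_ltn_trans (leq0n i) ltiN).
have -> : (1 - q ^+ N)^-1 * (1 + S1 - q ^+ N * (1 + S2)) = 1 + (1 - q ^+ N)^-1 * (S1 - q ^+ N * S2).
  by field.
rewrite !mulrDr !mulr1 addrACA -qKII_coefm0; congr (_ + _).
rewrite /S1 /S2 [q ^+ N * (\sum_(k < _) _)]mulr_sumr -mulrDr -sumrB !mulr_sumr -big_split;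
  apply: eq_bigr => [[k ltk]] _ /=.
rewrite -(comb2_mulr _ (qKII_coefm _ ltiN)); last by lia.
ring.
Qed.

Lemma qKIII_minus i z : (i < N)%N ->
  (1 - z) / (1 - q ^+ N) * K (QKParam (q * a) N.-1) i (q * z)
  = Pm qKIII 1 i * K (QKParam a N) i.+1 z + Pm qKIII 0 i * K (QKParam a N) i z.
Proof.
move=> ltiN; rewrite [K (QKParam (q * a) _) _ _](@qKrawtchoukE _ _ hq _ _ _ i.+1) //.
rewrite !(@qKrawtchoukE _ _ hq _ _ _ i.+2) // ![in RHS]sum_qpochS !qKcoef0 //.
rewrite !mulrDr !mulr1 addrACA -qKIII_coefm0 add0r.
rewrite !mulr_sumr -big_split; apply: eq_bigr => [[k ltk]] _ /=.
rewrite -(comb2_mulr _ (qKIII_coefm _ _)); last by lia.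
by rewrite qpochSl [q * z]mulrC; ring.
Qed.

End Relations.

(** * The relations as expansions *)
Section Ext.
Variables (F : fieldType) (q : F).

(** R_j extended by zero to all integers j, so that the sums in an expansion need no
    range condition. *)
Definition qKext (rho : qKparam F) (j : int) (z : F) : F :=
  if in_range (qK_N rho) j then qKrawtchouk q rho `|j|%N z else 0.

Lemma qKext_nat rho (i : nat) z : (i <= qK_N rho)%N ->
  qKext rho i%:Z z = qKrawtchouk q rho i z.
Proof. by move=> le; rewrite /qKext /in_range ifT //; lia. Qed.

Lemma qKext_out rho j z : ~~ in_range (qK_N rho) j -> qKext rho j z = 0.
Proof. by rewrite /qKext => /negbTE ->. Qed.

Lemma sum_in_range rho (i : nat) (eps : seq int) (Phi : int -> nat -> F) z :
  \sum_(e <- eps | in_range (qK_N rho) (i%:Z + e))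
     Phi e i * qKrawtchouk q rho `|(i%:Z + e)%R|%N z
  = \sum_(e <- eps) Phi e i * qKext rho (i%:Z + e) z.
Proof.
rewrite big_mkcond; apply: eq_bigr => e _; rewrite /qKext.
by case: ifP; rewrite ?mulr0.
Qed.

(** The points z at which an expansion with index i is required to hold. *)
Definition expansion_domain (rho rho' : qKparam F) (eta : int) (eps : seq int) (i : nat) (z : F) :=
  (forall e : int, e \in eps -> i%:Z + e <= (qK_N rho')%:Z) \/
  (on_grid q (qK_N rho) z /\ on_grid q (qK_N rho') (q ^ (- eta) * z)).

Lemma expansionP rho rho' eta eps lam Phi :
  expansion q rho rho' eta eps lam Phi <->
  forall i : nat, (i <= qK_N rho)%N ->
    (forall e : int, e \in eps -> ~~ in_range (qK_N rho') (i%:Z + e) -> Phi e i = 0) /\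
    (forall z, z != 0 -> expansion_domain rho rho' eta eps i z ->
       lam z * qKrawtchouk q rho i z =
       \sum_(e <- eps) Phi e i * qKext rho' (i%:Z + e) (q ^ (- eta) * z)).
Proof.
by split=> h i /h [h0 h1]; split=> // z z0 hz; rewrite h1 // ?sum_in_range // -sum_in_range.
Qed.

(** The data of the cases of type A_2, the value [None] standing for the trivial
    relation. *)
Definition oqK_eta (o : option qK_case) : int := oapp qK_eta 0 o.
Definition oqK_bar (o : option qK_case) (rho : qKparam F) : qKparam F :=
  if o is Some c then qK_bar q c rho else rho.
Definition oqK_Phip (o : option qK_case) (rho : qKparam F) : int -> nat -> F :=
  if o is Some c then qK_Phip q c rho else fun e _ => (e == 0)%:R.
Definition oqK_lamm (o : option qK_case) (rho : qKparam F) : F -> F :=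
  if o is Some c then qK_lamm q c rho else fun _ => 1.
Definition oqK_Phim (o : option qK_case) (rho : qKparam F) : int -> nat -> F :=
  if o is Some c then qK_Phim q c rho else fun e _ => (e == 0)%:R.

(** Whether the case replaces N by N - 1. *)
Definition lowers (o : option qK_case) : bool :=
  match o with Some qKII | Some qKIII => true | _ => false end.

Hypothesis hq : generic_base q.

Lemma oqK_barN o rho : qK_N (oqK_bar o rho) = (qK_N rho - lowers o)%N.
Proof. by case: o rho => [[]|] [a N] /=; rewrite ?subn0 ?subn1. Qed.

Lemma oqK_Phip00 o rho : generic_param q rho -> (lowers o <= qK_N rho)%N ->
  oqK_Phip o rho 0 0%N = 1.
Proof.
by case: o rho => [c|] [a N] //= ha hN; apply: (qK_Phip00 hq ha); case: c hN.
Qed.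

Lemma oqK_contiguity o rho : generic_param q rho -> (lowers o <= qK_N rho)%N ->
  A2_contiguity q (oqK_eta o) rho (oqK_bar o rho) (fun _ => 1) (oqK_Phip o rho).
Proof.
move=> ha hN; split; last by rewrite oqK_Phip00 ?oner_neq0.
apply/expansionP => i lei; split=> [e|z z0 hz].
  rewrite !inE => /orP [] /eqP ->; rewrite oqK_barN /in_range => hi.
    case: o rho ha hN lei hi => [c|] [a N] //= ha hN lei hi; last by lia.
    have -> : i = N by case: c hN hi => /=; lia.
    by apply: qK_Phip0N => //; case: c hN hi => //=; lia.
  have -> : i = 0%N by lia.
  by case: o rho {ha hN lei hi} => [[]|] [a N] //=; rewrite /qK_Phip /= expr0 subrr ?(mulr0, mul0r).
rewrite mul1r !big_cons big_nil !addr0; case: i lei hz => [|i] lei hz.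
  rewrite [qKext _ (_ + -1) _]qKext_out // mulr0 addr0 qKext_nat // oqK_Phip00 // mul1r.
  by rewrite !(qKrawtchouk0 hq).
have -> : i.+1%:Z + -1 = i by lia.
case: o rho ha hN lei hz => [c|] [a N] //= ha hN lei hz; last first.
  by rewrite qKext_nat // mul1r mul0r addr0 oppr0 expr0z mul1r.
have dom : (i.+1 <= qK_N (qK_bar q c (QKParam a N)))%N \/ (i.+1 = N /\ c <> qKI).
  by case: c hN {hz} => /= hN; [left | |]; rewrite ?lei //; (have [?|?] := ltnP i.+1 N; [left;
    lia | right; split=> //; lia]).
have hN' : (i <= qK_N (qK_bar q c (QKParam a N)))%N by case: c hN {hz dom} => /=; lia.
rewrite [qKext _ i _]qKext_nat //; case: dom => [le | [ei nc]]; last subst N.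
  rewrite qKext_nat //; case: c {hz hN'} hN le => hN /= le.
  - by rewrite oppr0 expr0z mul1r (qKI_plus hq ha).
  - by rewrite oppr0 expr0z mul1r (qKII_plus hq ha) //; lia.
  - by rewrite opprK expr1z (qKIII_plus hq ha) //; lia.
rewrite qKext_out; last by case: c nc {hz hN'} hN => //=; rewrite /in_range; lia.
rewrite mulr0 add0r; case: hz => [/(_ 0 (mem_head _ _))|[_]].
  by case: c nc {hN'} hN => //=; lia.
case=> n; case: c nc {hN'} hN => //= _ hN len e.
- move: e; rewrite oppr0 expr0z mul1r => ->.
  by rewrite (qKII_plusN hq ha) //; lia.
- by rewrite e; move: e; rewrite opprK expr1z => /(qKIII_plusN hq ha) ->.
Qed.

Lemma oqK_associated o rho : generic_param q rho -> (lowers o <= qK_N rho)%N ->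
  A2_associated q (oqK_eta o) rho (oqK_bar o rho) (oqK_lamm o rho) (oqK_Phim o rho).
Proof.
move=> ha hN; apply/expansionP => i; rewrite oqK_barN => lei; split=> [e|z z0 hz].
  rewrite !inE => /orP [] /eqP ->; rewrite /in_range => hi; last by lia.
  case: o rho ha hN lei hi => [c|] [a N] //= ha hN lei hi.
  have [ei ->] : i = N /\ c = qKI by case: c hN lei hi => /= *; split => //; lia.
  by rewrite /qK_Phim /= ei subrr mul0r.
rewrite opprK !big_cons big_nil !addr0.
case: o rho ha hN lei hz => [c|] [a N] //= ha hN lei hz; last first.
  rewrite [qKext _ i _]qKext_nat; last by move: lei => /=; lia.
  by rewrite !mul0r add0r expr0z ?oppr0 !mul1r.
have z1 : q * (q^-1 * z) = z by rewrite mulrA divff ?mul1r ?(q_neq0 hq).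
rewrite [qKext _ i _]qKext_nat /=; last by lia.
have [ltiN|leNi] := ltnP i N.
  have -> : i%:Z + 1 = i.+1 by lia.
  rewrite qKext_nat //; case: c {hz} hN lei => /= hN lei.
  - by rewrite expr0z mul1r (qKI_minus hq ha (ltnW ltiN) (or_introl ltiN)) ltiN.
  - by rewrite expr0z mul1r (qKII_minus hq ha).
  - by rewrite -{2}z1 exprN1 (qKIII_minus hq ha).
have [ei ec] : i = N /\ c = qKI by case: c {hz} hN lei => /= *; split => //; lia.
subst i c; rewrite qKext_out ?mulr0 ?add0r; last by rewrite /in_range /=; lia.
rewrite /= expr0z mul1r; have [h|[h _]] := hz; first by have := h 1 (mem_head _ _) => /=; lia.
by rewrite (qKI_minus hq ha) // ?ltnn ?add0r //; right.
Qed.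

End Ext.

(** * Weight, Pearson equation and orthogonality *)
Lemma coef_size_neq0 (R : nzRingType) (f : {poly R}) m : size f = m.+1 -> f`_m != 0.
Proof. by move=> sf; have := lead_coef_eq0 f; rewrite lead_coefE sf -size_poly_eq0 sf => ->. Qed.

Section GradedBasis.
Variables (F : fieldType) (B : nat -> {poly F}) (n : nat).
Hypothesis sizeB : forall k, (k < n)%N -> size (B k) = k.+1.

(** A family of polynomials of degrees 0, ..., n - 1 spans the polynomials of degree
    less than n, and is free. *)
Lemma graded_basis_span (f : {poly F}) : (size f <= n)%N ->
  exists c : nat -> F, f = \sum_(k < n) c k *: B k.
Proof.
elim: n sizeB f => [|m IH] sB f.
  by rewrite leqn0 size_poly_eq0 => /eqP ->; exists (fun _ => 0); rewrite big_ord0.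
move=> sf; have sm := sB m (ltnSn m).
have lB := coef_size_neq0 sm.
pose t := f`_m / (B m)`_m.
have sB' k : (k < m)%N -> size (B k) = k.+1 by move=> km; apply: sB; lia.
have [|c ec] := IH sB' (f - t *: B m).
  apply/leq_sizeP => j lej; rewrite coefB coefZ.
  move: lej; rewrite leq_eqVlt => /predU1P [<-|ltmj]; first by rewrite divfK // subrr.
  by rewrite !nth_default ?mulr0 ?subrr // ?sm // (leq_trans sf).
exists (fun k => if k == m then t else c k).
rewrite big_ord_recr /= eqxx -[LHS](subrK (t *: B m)) ec; congr (_ + _).
by apply: eq_bigr => k _; rewrite ltn_eqF.
Qed.

Lemma graded_basis_free (c : nat -> F) :
  \sum_(k < n) c k *: B k = 0 -> forall k, (k < n)%N -> c k = 0.
Proof.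
elim: n sizeB => [//|m IH] sB; have sm := sB m (ltnSn m).
have lB := coef_size_neq0 sm.
rewrite big_ord_recr /= => h.
have cm : c m = 0.
  have := congr1 (fun p : {poly F} => p`_m) h; rewrite coefD coefZ coef0 coef_sum big1 => [|k _].
    by rewrite add0r => /eqP; rewrite mulf_eq0 (negbTE lB) orbF => /eqP.
  by rewrite coefZ nth_default ?mulr0 // sB // ltnW // ltnS.
move: h; rewrite cm scale0r addr0 => /(IH _) h k; rewrite ltnS leq_eqVlt => /predU1P [->//|].
by apply: h => l ll; apply: sB; lia.
Qed.

End GradedBasis.

Section Weight.
Variables (F : fieldType) (q : F).
Hypothesis hq : generic_base q.
Variables (a : F) (N : nat).

(** The orthogonality weight of the q-Krawtchouk polynomials at x. *)
Definition qKweight x := qpoch q (q ^- N) x / qpoch q q x / a ^+ x.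

(** The orthogonality functional.  It acts on functions rather than on polynomials,
    so that dilations of the variable need no polynomial composition. *)
Definition qKfun (g : F -> F) := \sum_(x < N.+1) qKweight x * g (q ^- x).

Lemma eq_qKfun g h : g =1 h -> qKfun g = qKfun h.
Proof. by move=> e; apply: eq_bigr => x _; rewrite e. Qed.

Lemma qKfunZ c g : qKfun (fun z => c * g z) = c * qKfun g.
Proof. by rewrite /qKfun mulr_sumr; apply: eq_bigr => x _; rewrite mulrCA. Qed.

Lemma qKfunD g h : qKfun (fun z => g z + h z) = qKfun g + qKfun h.
Proof. by rewrite /qKfun -big_split; apply: eq_bigr => x _; rewrite mulrDr. Qed.

Lemma qKfunB g h : qKfun (fun z => g z - h z) = qKfun g - qKfun h.
Proof. by rewrite /qKfun -sumrB; apply: eq_bigr => x _; rewrite mulrBr. Qed.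

Lemma qKfun_sum n (g : 'I_n -> F -> F) : qKfun (fun z => \sum_k g k z) = \sum_k qKfun (g k).
Proof. by rewrite /qKfun exchange_big; apply: eq_bigr => x _; rewrite mulr_sumr. Qed.

Lemma qKfun0 : qKfun (fun _ => 0) = 0.
Proof. by rewrite /qKfun big1 // => x _; rewrite mulr0. Qed.

Hypothesis ha : generic_param q (QKParam a N).
Let q0 := q_neq0 hq.
Let qX0 n : q ^+ n != 0 := qX_neq0 hq n.
Let qX1 n : (0 < n)%N -> 1 - q ^+ n != 0 := @qX_neq1 _ _ hq n.
Let aX1 n : 1 - a * q ^+ n != 0 := generic_alphaX hq n ha.
Let a0 : a != 0. Proof. by case: ha. Qed.

Lemma qKweight_neq0 x : (x <= N)%N -> qKweight x != 0.
Proof.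
by move=> lex; rewrite !mulf_neq0 ?invr_neq0 ?expf_neq0 ?(qpochqq_neq0 hq) ?(qpochqN_neq0 hq).
Qed.

Lemma qKweightS x : a * q * qKweight x.+1 * (1 - q ^- x.+1) = qKweight x * (q ^- N - q ^- x).
Proof.
rewrite /qKweight !qpochS -exprS.
have := qX1 (ltn0Sn x); have D := qpochqq_neq0 hq x; move: D (qX0 x) (qX0 N) (expf_neq0 x a0).
rewrite !exprS; move: (qpoch q (q ^- N) _) (qpoch q q _) => b c;
  move: (q ^+ x) (q ^+ N) (a ^+ x) => u w v c0 u0 w0 v0 h.
by fld.
Qed.

(** The Pearson equation.  The two sides differ by a shift of the summation index; the
    boundary terms vanish because 1 - z is zero at x = 0 and q^-N - z is zero at x = N. *)
Lemma qKfun_pearson f :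
  qKfun (fun z => (q ^- N - z) * f z) = a * q * qKfun (fun z => (1 - z) * f (q * z)).
Proof.
rewrite /qKfun big_ord_recr [in RHS]big_ord_recl /= subrr expr0 invr1 subrr !mul0r !mulr0 addr0
  add0r.
rewrite mulr_sumr; apply: eq_bigr => x _.
have -> : q * q ^- bump 0 x = q ^- x by rewrite /bump add1n exprS invfM mulrA divff // mul1r.
by rewrite /bump add1n [LHS]mulrA -qKweightS; ring.
Qed.

Lemma qKfun_qpochS k :
  (1 - a * q ^+ k.+1) * qKfun (fun z => qpoch q z k.+1) =
    (1 - q ^+ k / q ^+ N) * qKfun (fun z => qpoch q z k).
Proof.
have := qKfun_pearson (fun z => qpoch q z k).
rewrite [in RHS](@eq_qKfun _ (fun z => qpoch q z k.+1)); last by move=> z;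
  rewrite qpochSl [q * z]mulrC.
rewrite (@eq_qKfun _ (fun z => (q ^- N - q ^- k) * qpoch q z k + q ^- k * qpoch q z k.+1));
  last first.
  by move=> z; rewrite mulrBl (qpoch_mulz hq); ring.
rewrite qKfunD !qKfunZ exprS; set X := qKfun (fun z => qpoch q z k.+1); set Y := qKfun _.
move: X Y (qX0 k) (qX0 N); move: (q ^+ k) (q ^+ N) => u w x y u0 w0 e.
apply: (mulfI (invr_neq0 u0)).
transitivity (u^-1 * x - a * q * x); first by field.
by rewrite -e; field; apply/andP.
Qed.

Lemma qKfun_qpoch k :
  qpoch q (a * q) k * qKfun (fun z => qpoch q z k) = qpoch q (q ^- N) k * qKfun (fun _ => 1).
Proof.
elim: k => [|k IH].
  by rewrite !qpoch0; congr (_ * _); apply: eq_qKfun => z; rewrite qpoch0.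
rewrite !qpochS -[a * q * _]mulrA -exprS -mulrA qKfun_qpochS mulrCA IH; ring.
Qed.

(** A partial sum of the series 2phi1(b, c; b c q; q, q).  For b = q^-i and n = i it
    vanishes. *)
Lemma sum_2phi1 b c n : (forall k, b * c * q * q ^+ k != 1) ->
  \sum_(k < n.+1) qpoch q b k * qpoch q c k / (qpoch q q k * qpoch q (b * c * q) k) * q ^+ k
  = qpoch q (b * q) n * qpoch q (c * q) n / (qpoch q q n * qpoch q (b * c * q) n).
Proof.
move=> h; elim: n => [|n IH]; first by rewrite big_ord1 !qpoch0 expr0 mulr1.
rewrite big_ord_recr /= IH ![qpoch q b _]qpochSl ![qpoch q c _]qpochSl !qpochS.
have D1 := qpochqq_neq0 hq n; have D2 : qpoch q (b * c * q) n != 0 by apply: qpoch_neq0 => l _;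
  exact: h.
have D3 : 1 - b * c * q * q ^+ n != 0 by rewrite subr_eq0 eq_sym h.
have D4 := qX1 (ltn0Sn n); move: D1 D2 D3 D4; rewrite exprS.
move: (qpoch _ _ _) (qpoch _ _ _) (qpoch _ _ _) (qpoch _ _ _) (q ^+ n) => x y z t u D1 D2 D3 D4.
by fld.
Qed.

(** The basis (z; q)_k as polynomials in z. *)
Definition qphi k : {poly F} := \prod_(l < k) (1 - q ^+ l *: 'X).

Lemma qphiE k z : (qphi k).[z] = qpoch q z k.
Proof.
rewrite horner_prod; apply: eq_bigr => l _.
by rewrite hornerD hornerN hornerZ hornerX hornerC mulrC.
Qed.

Lemma size_qphi k : size (qphi k) = k.+1.
Proof.
elim: k => [|k IH]; first by rewrite /qphi big_ord0 size_poly1.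
have sz : size (1 - q ^+ k *: 'X) = 2%N.
  by rewrite addrC size_polyDl size_polyN size_scale // ?size_polyX // size_poly1.
rewrite /qphi big_ord_recr -/(qphi k) size_mul ?IH ?sz ?addn2 //.
  by rewrite -size_poly_eq0 IH.
by rewrite -size_poly_eq0 sz.
Qed.

(** The total mass is nonzero: otherwise L would vanish on all polynomials by
    [qKfun_qpoch], but (q z; q)_N is zero at every point of the grid except z = 1. *)
Lemma qKfun1_neq0 : qKfun (fun _ => 1) != 0.
Proof.
apply/eqP => h0.
have hk k : qKfun (fun z => qpoch q z k) = 0.
  have := qKfun_qpoch k; rewrite h0 mulr0 => /eqP; rewrite mulf_eq0 => /orP [|/eqP//].
  rewrite (negbTE (qpoch_neq0 _)) // => l _; rewrite -mulrA -exprS.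
  by have := aX1 l.+1; rewrite subr_eq0 eq_sym.
have [|c ec] := @graded_basis_span _ qphi N.+1 (fun k _ => size_qphi k) (qphi N \Po (q *: 'X)).
  by rewrite size_comp_poly2 ?size_qphi // size_scale ?size_polyX.
have : qKfun (fun z => (qphi N \Po (q *: 'X)).[z]) = 0.
  rewrite ec (@eq_qKfun _ (fun z => \sum_(k < N.+1) c k * qpoch q z k)).
    by rewrite qKfun_sum big1 // => k _; rewrite qKfunZ hk mulr0.
  by move=> z; rewrite horner_sum; apply: eq_bigr => k _; rewrite hornerZ qphiE.
rewrite /qKfun big_ord_recl big1 => [|x _].
  rewrite addr0 horner_comp qphiE hornerZ hornerX invr1 mulr1 => /eqP.
  by rewrite mulf_eq0 (negbTE (qKweight_neq0 _)) // (negbTE (qpochqq_neq0 hq _)).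
rewrite horner_comp qphiE hornerZ hornerX /= /bump /= add1n exprS invfM mulrA divff // mul1r.
by rewrite (qpochqN_eq0 hq) ?mulr0.
Qed.

(** R_i(z; a, N) as a polynomial in z. *)
Definition qKpoly i : {poly F} := \sum_(k < i.+1) qKcoef q a N i k *: qphi k.

Lemma qKpolyE i z : (qKpoly i).[z] = qKrawtchouk q (QKParam a N) i z.
Proof.
rewrite (@qKrawtchoukE _ _ hq _ _ _ i.+1) // horner_sum; apply: eq_bigr => k _.
by rewrite hornerZ qphiE.
Qed.

Lemma size_qKpoly i : (i <= N)%N -> size (qKpoly i) = i.+1.
Proof.
move=> lei; have c0 : qKcoef q a N i i != 0.
  rewrite /qKcoef /qKnum !mulf_neq0 ?invr_neq0 ?mulf_neq0 ?(qpochqq_neq0 hq) ?(qpochqN_neq0 hq) //.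
  apply: qpoch_neq0 => l _; rewrite -mulrA -exprD.
  by have := aX1 (i + l); rewrite subr_eq0 eq_sym.
rewrite /qKpoly big_ord_recr /= addrC size_polyDl size_scale ?size_qphi //.
rewrite ltnS; apply: (leq_trans (size_sum _ _ _)); apply/bigmax_leqP => k _.
by rewrite (leq_trans (size_scale_leq _ _)) // size_qphi.
Qed.

Lemma qKfun_qKpoly i : (0 < i <= N)%N -> qKfun (fun z => (qKpoly i).[z]) = 0.
Proof.
move=> /andP [i0 lei].
rewrite (@eq_qKfun _ (fun z => \sum_(k < i.+1) qKcoef q a N i k * qpoch q z k)); last first.
  by move=> z; rewrite qKpolyE (@qKrawtchoukE _ _ hq _ _ _ i.+1).
have e : q ^- i * (a * q ^+ i) * q = a * q by rewrite mulrCA mulVf // mulr1.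
have h k : q ^- i * (a * q ^+ i) * q * q ^+ k != 1.
  by rewrite e -mulrA -exprS; have := aX1 k.+1; rewrite subr_eq0 eq_sym.
rewrite qKfun_sum.
transitivity (qKfun (fun _ => 1) * \sum_(k < i.+1) qpoch q (q ^- i) k * qpoch q (a * q ^+ i) k /
  (qpoch q q k * qpoch q (q ^- i * (a * q ^+ i) * q) k) * q ^+ k).
  rewrite mulr_sumr; apply: eq_bigr => [[k ltk]] _ /=; rewrite qKfunZ e.
  have D1 : qpoch q (a * q) k != 0 by apply: qpoch_neq0 => l _; rewrite -e.
  have D2 := qpochqq_neq0 hq k.
  have D3 : qpoch q (q ^- N) k != 0 by apply: (qpochqN_neq0 hq); lia.
  apply: (mulfI D1); rewrite mulrCA qKfun_qpoch /qKcoef /qKnum.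
  by move: D1 D2 D3; move: (qpoch _ _ _) (qpoch _ _ _) (qpoch _ _ _) (qpoch _ _ _) => x y z t *;
    fld.
rewrite sum_2phi1 //.
case: i i0 {lei e h} => // i _.
have -> : q ^- i.+1 * q = q ^- i by rewrite exprSr invfM -mulrA mulVf // mulr1.
by rewrite [qpoch q (q ^- i) _](qpochqN_eq0 hq) ?mul0r ?mulr0.
Qed.

(** The three-term recurrence, obtained by composing qKI with its associated
    relation. *)
Lemma qK_recurrence i : (i.+1 < N)%N -> exists A B C, C != 0 /\ forall z,
  z * (qKpoly i.+1).[z] = A * (qKpoly i.+2).[z] + B * (qKpoly i.+1).[z] + C * (qKpoly i).[z].
Proof.
move=> ltiN; set P := fun e => qK_Phip q qKI (QKParam a N) e i.+1.
set M := fun e j => qK_Phim q qKI (QKParam a N) e j.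
exists (P 0 * M 1 i.+1 / q ^+ N), ((P 0 * M 0 i.+1 + P (-1) * M 1 i) / q ^+ N),
  (P (-1) * M 0 i / q ^+ N).
split=> [|z].
  have P0 : P (-1) != 0 by rewrite /P /qK_Phip /= !mulf_neq0 ?invr_neq0 ?qX1.
  have M0 : M 0 i != 0 by rewrite /M /qK_Phim /= !mulf_neq0 ?invr_neq0.
  exact: mulf_neq0 (mulf_neq0 P0 M0) (invr_neq0 (qX0 N)).
apply: (mulfI (qX0 N)); rewrite !qKpolyE mulrA [in LHS](qKI_plus hq ha) ?(ltnW ltiN) // mulrDr.
rewrite !(mulrCA (q ^+ N * z)) !(qKI_minus hq ha) ?ltiN ?(ltnW ltiN) //; try by left.
  by rewrite /P /M; field.
by rewrite ltnW// ltnW.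
Qed.

(** Orthogonality and regularity, by induction on the power of z with the three-term
    recurrence.  The bound on i + j keeps the recurrence away from the index N. *)
Lemma qKfun_ortho j i : (i + j <= N)%N ->
  ((j < i)%N -> qKfun (fun z => z ^+ j * (qKpoly i).[z]) = 0) /\
  (j = i -> qKfun (fun z => z ^+ j * (qKpoly i).[z]) != 0).
Proof.
elim: j i => [|j IH] i leN.
  rewrite addn0 in leN; split=> [i0|<-].
    by rewrite -[RHS](@qKfun_qKpoly i) ?i0 //; apply: eq_qKfun => z; rewrite mul1r.
  rewrite (@eq_qKfun _ (fun _ => 1)) ?qKfun1_neq0 // => z.
  by rewrite mul1r qKpolyE qKrawtchouk0.
case: i leN => [|i] leN; first by split.
have [A [B [C [C0 rec]]]] : exists A B C, C != 0 /\ forall z,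
  z * (qKpoly i.+1).[z] = A * (qKpoly i.+2).[z] + B * (qKpoly i.+1).[z] + C * (qKpoly i).[z].
  by apply: qK_recurrence; lia.
pose G i := qKfun (fun z => z ^+ j * (qKpoly i).[z]).
have -> : qKfun (fun z => z ^+ j.+1 * (qKpoly i.+1).[z]) = A * G i.+2 + B * G i.+1 + C * G i.
  rewrite -!qKfunZ -!qKfunD; apply: eq_qKfun => z.
  by rewrite exprSr -mulrA rec; ring.
have [G2 _] : ((j < i.+2)%N -> G i.+2 = 0) /\ (j = i.+2 -> G i.+2 != 0) by apply: IH; lia.
have [G1 _] : ((j < i.+1)%N -> G i.+1 = 0) /\ (j = i.+1 -> G i.+1 != 0) by apply: IH; lia.
have [G0 G0'] : ((j < i)%N -> G i = 0) /\ (j = i -> G i != 0) by apply: IH; lia.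
split=> [ltji|[eji]].
  by rewrite G2 ?G1 ?G0 ?mulr0 ?addr0 //; lia.
by rewrite G2 ?G1 ?mulr0 ?add0r ?mulf_neq0 ?G0' //; lia.
Qed.

Lemma qKfun_horner_sum (g : {poly F}) n (h : F -> F) : (size g <= n)%N ->
  qKfun (fun z => g.[z] * h z) = \sum_(j < n) g`_j * qKfun (fun z => z ^+ j * h z).
Proof.
move=> sg; rewrite (@eq_qKfun _ (fun z => \sum_(j < n) g`_j * (z ^+ j * h z))).
  by rewrite qKfun_sum; apply: eq_bigr => j _; rewrite qKfunZ.
by move=> z; rewrite (horner_coef_wide _ sg) mulr_suml; apply: eq_bigr => j _; rewrite mulrA.
Qed.

Lemma qKfun_ortho_poly (g : {poly F}) i : (size g <= i)%N -> (i.*2 <= N)%N ->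
  qKfun (fun z => g.[z] * (qKpoly i).[z]) = 0.
Proof.
move=> sg lei; rewrite (qKfun_horner_sum _ sg) big1 // => [[j ltj]] _ /=.
have le : (i + j <= N)%N by lia.
by have [-> // _] := qKfun_ortho le; rewrite mulr0.
Qed.

Lemma qKfun_regular (g : {poly F}) i : size g = i.+1 -> (i.*2 <= N)%N ->
  qKfun (fun z => g.[z] * (qKpoly i).[z]) != 0.
Proof.
move=> sg lei; rewrite (qKfun_horner_sum _ (n :=
  i.+1)) ?sg // big_ord_recr big1 /= => [|[j ltj] _ /=].
  rewrite add0r mulf_neq0 //.
    exact: coef_size_neq0.
  have le : (i + i <= N)%N by lia.
  by have [_ ->] := qKfun_ortho le.
have le : (i + j <= N)%N by lia.
by have [-> // _] := qKfun_ortho le; rewrite mulr0.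
Qed.

(** A polynomial that is L-orthogonal to all polynomials of its degree is zero. *)
Lemma qKfun_separate (g : {poly F}) K : (size g <= K)%N -> (K.*2 <= N)%N ->
  (forall h : {poly F}, (size h <= K)%N -> qKfun (fun z => g.[z] * h.[z]) = 0) -> g = 0.
Proof.
move=> sg leK h; apply/eqP; rewrite -size_poly_eq0.
case E : (size g) => [//|i]; have /eqP := @qKfun_regular g i E ltac:(lia).
by case; apply: h; rewrite size_qKpoly; lia.
Qed.

End Weight.

(** * The ratio of two weights related by an expansion *)
Section Degree.
Variable F : fieldType.

Lemma size_mul_le (f g : {poly F}) m n : (size f <= m.+1)%N -> (size g <= n.+1)%N ->
  (size (f * g)%R <= (m + n).+1)%N.
Proof. by move=> hf hg; apply: leq_trans (size_polyMleq _ _) _; lia. Qed.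

Lemma size_add_le (f g : {poly F}) m : (size f <= m)%N -> (size g <= m)%N -> (size (f + g)%R <=
  m)%N.
Proof. by move=> hf hg; apply: leq_trans (size_polyD _ _) _; rewrite geq_max hf. Qed.

Lemma size_affine (b c : F) : (size (b%:P - c *: 'X)%R <= 2)%N.
Proof.
apply: size_add_le; first by rewrite (leq_trans (size_polyC_leq1 _)).
by rewrite size_polyN (leq_trans (size_scale_leq _ _)) // size_polyX.
Qed.

Lemma size_dilate (f : {poly F}) c : c != 0 -> size (f \Po (c *: 'X)) = size f.
Proof. by move=> c0; apply: size_comp_poly2; rewrite size_scale ?size_polyX. Qed.

Lemma horner_dilate (f : {poly F}) c z : (f \Po (c *: 'X)).[z] = f.[c * z].
Proof. by rewrite horner_comp hornerZ hornerX. Qed.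

End Degree.

Section Pearson.
Variables (F : fieldType) (q : F).
Hypothesis hq : generic_base q.
Variables (a at' : F) (N Nt : nat) (eta : int).
Hypothesis ha : generic_param q (QKParam a N).
Hypothesis hat : generic_param q (QKParam at' Nt).
Let q0 := q_neq0 hq.

Local Notation L := (qKfun q a N).
Local Notation Y := (q ^ (- eta)).

(** The functional of (at', Nt) read in the variable z, where z' = q^-eta z is the
    variable of its polynomials. *)
Definition shifted_qKfun (g : F -> F) := qKfun q at' Nt (fun z => g (q ^ eta * z)).
Local Notation Lt := shifted_qKfun.

Lemma YeK : Y * q ^ eta = 1.
Proof. by rewrite -expfzDr // addNr expr0z. Qed.

Lemma eq_shifted_qKfun g h : g =1 h -> Lt g = Lt h.
Proof. by move=> e; apply: eq_qKfun => z; rewrite e. Qed.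

Lemma shifted_pearson f :
  Lt (fun z => (q ^- Nt - Y * z) * f z) = at' * q * Lt (fun z => (1 - Y * z) * f (q * z)).
Proof.
rewrite /shifted_qKfun.
rewrite (@eq_qKfun _ _ _ _ _ (fun z => (q ^- Nt - z) * f (q ^ eta * z))); last first.
  by move=> z; rewrite mulrA YeK mul1r.
rewrite (qKfun_pearson hq hat (fun z => f (q ^ eta * z))); congr (_ * _).
by apply: eq_qKfun => z; rewrite mulrA YeK mul1r [q * (_ * _)]mulrCA.
Qed.

Variables (d : nat) (lam : {poly F}).

(** A functional f |-> L'[lam f] that kills R_i for d < i <= n has a density of degree
    at most d with respect to L, for polynomials of degree at most n. *)
Lemma functional_density n : (d <= n)%N -> (n.*2 <= N)%N ->
  (forall i, (d < i <= n)%N -> Lt (fun z => lam.[z] * (qKpoly q a N i).[z]) = 0) ->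
  exists2 p : {poly F}, (size p <= d.+1)%N &
    forall f : {poly F}, (size f <= n.+1)%N ->
      Lt (fun z => lam.[z] * f.[z]) = L (fun z => p.[z] * f.[z]).
Proof.
move=> dn nN h; pose R := qKpoly q a N.
have szR i : (i < n.+1)%N -> size (R i) = i.+1 by move=> ?; apply: (size_qKpoly hq ha); lia.
pose H i := L (fun z => (R i).[z] * (R i).[z]).
have H0 i : (i <= n)%N -> H i != 0 by move=> ?; apply: (qKfun_regular hq ha); rewrite ?szR; lia.
pose b i := Lt (fun z => lam.[z] * (R i).[z]) / H i.
have ortho i j : (i <= n)%N -> (j <= n)%N -> i != j -> L (fun z => (R i).[z] * (R j).[z]) = 0.
  move=> ni nj; rewrite neq_ltn => /orP [] ltij.
    by apply: (qKfun_ortho_poly hq ha); rewrite ?szR; lia.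
  rewrite (@eq_qKfun _ _ _ _ _ (fun z => (R j).[z] * (R i).[z])); last by move=> z; rewrite mulrC.
  by apply: (qKfun_ortho_poly hq ha); rewrite ?szR; lia.
(* It suffices to treat the basis of the R_i. *)
suff [p sp key] : exists2 p : {poly F}, (size p <= d.+1)%N &
    forall i, (i <= n)%N -> Lt (fun z => lam.[z] * (R i).[z]) = L (fun z => p.[z] * (R i).[z]).
  exists p => // f sf; have [c ->] := graded_basis_span szR sf.
  rewrite /shifted_qKfun (@eq_qKfun _ _ _ _ _ (fun z => \sum_(k < n.+1) c k * (lam.[q ^ eta * z]
    * (R k).[q ^ eta * z]))); last first.
    by move=> z; rewrite horner_sum mulr_sumr; apply: eq_bigr => k _; rewrite hornerZ mulrCA.
  rewrite [RHS](@eq_qKfun _ _ _ _ _ (fun z => \sum_(k < n.+1) c k * (p.[z] * (R k).[z])));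
    last first.
    by move=> z; rewrite horner_sum mulr_sumr; apply: eq_bigr => k _; rewrite hornerZ mulrCA.
  rewrite !qKfun_sum; apply: eq_bigr => k _; rewrite !qKfunZ; congr (_ * _).
  by rewrite -key //; have := ltn_ord k; lia.
exists (\sum_(j < d.+1) b j *: R j).
  apply: (leq_trans (size_sum _ _ _)); apply/bigmax_leqP => k _.
  by rewrite (leq_trans (size_scale_leq _ _)) // szR //; have := ltn_ord k; lia.
move=> i ni; rewrite [RHS](@eq_qKfun _ _ _ _ _ (fun z => \sum_(j < d.+1) b j * ((R j).[z] * (R
  i).[z]))); last first.
  by move=> z; rewrite horner_sum mulr_suml; apply: eq_bigr => j _; rewrite hornerZ mulrA.
rewrite qKfun_sum; under eq_bigr => j _ do rewrite qKfunZ.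
have [lei|lti] := leqP i d.
  rewrite (bigD1 (Ordinal (lei : (i < d.+1)%N))) //= big1 ?addr0 => [|j].
    by rewrite divfK ?H0.
  by rewrite -val_eqE /= => ne; rewrite ortho ?mulr0 //; have := ltn_ord j; lia.
by rewrite h ?lti // big1 // => j _; rewrite ortho ?mulr0 //; have := ltn_ord j; lia.
Qed.

Hypothesis lam0 : lam != 0.
Hypothesis size_lam : (size lam + d <= 3)%N.
Hypothesis (N20 : (20 <= N)%N) (Nt20 : (20 <= Nt)%N).

Lemma density_neq0 (p : {poly F}) n : (2 < n)%N ->
  (forall f : {poly F}, (size f <= n.+1)%N ->
      Lt (fun z => lam.[z] * f.[z]) = L (fun z => p.[z] * f.[z])) -> p != 0.
Proof.
move=> n3 hp; apply/eqP => p0; case/eqP: lam0.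
have s0 : q ^ eta != 0 by exact: qXz_neq0.
suff : lam \Po (q ^ eta *: 'X) = 0.
  by move/eqP; rewrite -size_poly_eq0 size_dilate // size_poly_eq0 => /eqP.
apply: (@qKfun_separate _ _ hq at' Nt hat _ 3); rewrite ?size_dilate //; [lia|lia|].
move=> h sh; have := hp (h \Po (q ^ (- eta) *: 'X)); rewrite size_dilate ?qXz_neq0 // p0.
rewrite [in RHS](@eq_qKfun _ _ _ _ _ (fun _ => 0)) ?qKfun0 => [<-|z]; last by rewrite horner0 mul0r.
  by apply: eq_qKfun => z; rewrite !horner_dilate mulrA YeK mul1r.
by rewrite (leq_trans sh) //; lia.
Qed.

(** The density p of [functional_density] satisfies the polynomial identity that
    expresses p w = lam w' through the Pearson equations.  The products that occur have
    degree at most 10. *)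
Lemma weight_ratio :
  (forall i, (d < i <= 10)%N -> Lt (fun z => lam.[z] * (qKpoly q a N i).[z]) = 0) ->
  exists p : {poly F}, [/\ p != 0, (size p <= d.+1)%N & forall z,
    at' * (q ^- N - z) * (1 - Y * (q^-1 * z)) * p.[q^-1 * z] * lam.[z]
    = a * (q ^- Nt - Y * z) * (1 - q^-1 * z) * p.[z] * lam.[q^-1 * z]].
Proof.
move=> h; have [||p sp hp] := @functional_density 10 _ _ h; [lia|lia|].
have p0 : p != 0 by apply: (@density_neq0 p 10).
exists p; split=> //.
have qi0 : q^-1 != 0 by rewrite invr_eq0.
pose dn (f : {poly F}) := f \Po (q *: 'X); pose up (f : {poly F}) := f \Po (q^-1 *: 'X).
pose af (b c : F) : {poly F} := b%:P - c *: 'X.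
have afE b c z : (af b c).[z] = b - c * z by rewrite !hornerE.
have dnE f z : (dn f).[z] = f.[q * z] by rewrite horner_dilate.
have upE f z : (up f).[z] = f.[q^-1 * z] by rewrite horner_dilate.
(* Q1 and Q3 are the two sides of the identity; T2 mediates between them, through
   the Pearson equation of L on the side of Q1 and that of L' on the side of Q3. *)
pose Q1 : {poly F} := (at' *: af (q ^- N) 1) * (af 1 (Y * q^-1)) * up p * lam.
pose Q3 : {poly F} := (a *: af (q ^- Nt) Y) * (af 1 q^-1) * p * up lam.
pose T2 h : {poly F} := (a * q * at' * q) *: (af 1 1 * af 1 Y * dn p * dn lam * dn h).
have [m sm hm] : exists2 m, (size lam <= m.+1)%N & (m + d <= 2)%N.
  by exists (size lam).-1; move: lam0; rewrite -size_poly_gt0; lia.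
have sQ1 : (size Q1 <= (1 + 1 + d + m).+1)%N.
  apply: size_mul_le => //; apply: size_mul_le; last by rewrite size_dilate.
  apply: size_mul_le; last exact: size_affine.
  exact: leq_trans (size_scale_leq _ _) (size_affine _ _).
have sQ3 : (size Q3 <= (1 + 1 + d + m).+1)%N.
  apply: size_mul_le; last by rewrite size_dilate.
  apply: size_mul_le => //; apply: size_mul_le; last exact: size_affine.
  exact: leq_trans (size_scale_leq _ _) (size_affine _ _).
suff Q0 : p * (Q1 - Q3) = 0.
  move=> z; move/eqP: Q0; rewrite mulf_eq0 (negbTE p0) subr_eq0 /= => /eqP /(congr1 (horner^~ z)).
  rewrite !hornerM !hornerZ !afE !upE => ez.
  by apply: etrans (etrans ez _); ring.
apply: (@qKfun_separate _ _ hq a N ha _ 7); [|lia|].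
  apply: leq_trans (_ : ((d + (1 + 1 + d + m)).+1 <= 7)%N); last by lia.
  by apply: size_mul_le => //; apply: size_add_le; rewrite ?size_polyN.
move=> g sg.
have sT2 : (size (T2 g) <= 11)%N.
  apply: leq_trans (size_scale_leq _ _) _.
  apply: leq_trans (_ : ((1 + 1 + d + m + 6).+1 <= 11)%N); last by lia.
  do 3! (apply: size_mul_le; last by rewrite size_dilate).
  by apply: size_mul_le; exact: size_affine.
have sT3 : (size (Q3 * g)%R <= 11)%N.
  apply: leq_trans (_ : (((1 + 1 + d + m) + 6).+1 <= 11)%N); last by lia.
  exact: size_mul_le.
have e1 : L (fun z => p.[z] * (Q1 * g).[z]) = q^-1 * L (fun z => p.[z] * (T2 g).[z]).
  have := qKfun_pearson hq ha (fun z => p.[z] * (up p).[z] * at' * (1 - Y * (q^-1 * z)) * lam.[z]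
    * g.[z]).
  rewrite (@eq_qKfun _ _ _ _ _ (fun z => p.[z] * (Q1 * g).[z])) => [->|z]; last first.
    by rewrite !hornerM !hornerZ !afE; ring.
  rewrite -!qKfunZ; apply: eq_qKfun => z.
  rewrite !hornerZ !hornerM !afE !dnE !upE mulKf //; field; exact: q0.
have e3 : Lt (fun z => lam.[z] * (T2 g).[z]) = q * Lt (fun z => lam.[z] * (Q3 * g).[z]).
  have := shifted_pearson (fun z => (up lam).[z] * lam.[z] * a * q * (1 - q^-1 * z) * p.[z] *
    g.[z]).
  rewrite (@eq_shifted_qKfun _ (fun z => q * (lam.[z] * (Q3 * g).[z]))) => [e|z]; last first.
    by rewrite !hornerM !hornerZ !afE; ring.
  rewrite /shifted_qKfun -qKfunZ -/(Lt (fun z => q * (lam.[z] * (Q3 * g).[z]))) e.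
  rewrite /shifted_qKfun -qKfunZ; apply: eq_qKfun => z.
  rewrite !hornerZ !hornerM !afE !dnE !upE mulKf //; ring.
rewrite (@eq_qKfun _ _ _ _ _ (fun z => p.[z] * (Q1 * g).[z] - p.[z] * (Q3 * g).[z])); last first.
  by move=> z; rewrite hornerM hornerD hornerN (hornerM Q1) (hornerM Q3); ring.
by rewrite qKfunB e1 -hp // e3 mulKf // hp // subrr.
Qed.

End Pearson.

(** * Zeros of the ratio on the lattice of powers of q *)
Section Multiplicity.
Variable F : fieldType.

Lemma mupZ (c x : F) (f : {poly F}) : c != 0 -> mup x (c *: f) = mup x f.
Proof. by move=> c0; rewrite -mul_polyC mupMr // rootC. Qed.

Lemma mup_affine (b c x : F) : c != 0 -> mup x (b%:P - c *: 'X) = (b / c == x).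
Proof.
move=> c0; have -> : b%:P - c *: 'X = (- c) *: ('X - (b / c)%:P) ^+ 1.
  have e : b%:P = c *: (b / c)%:P by rewrite -mul_polyC -polyCM mulrCA divff ?mulr1.
  by rewrite expr1 scalerBr !scaleNr opprK addrC -e.
by rewrite mupZ ?oppr_eq0 // mup_XsubCX; case: eqP.
Qed.

Lemma affine_neq0 (b c : F) : c != 0 -> b%:P - c *: 'X != 0.
Proof.
move=> c0; rewrite -size_poly_eq0 addrC size_polyDl size_polyN size_scale ?size_polyX //.
by rewrite ltnS size_polyC_leq1.
Qed.

Lemma mup_affine_prod (k b c b' c' x : F) (f g : {poly F}) :
  k != 0 -> c != 0 -> c' != 0 -> f != 0 -> g != 0 ->
  mup x (k *: ((b%:P - c *: 'X) * (b'%:P - c' *: 'X) * f * g))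
  = ((b / c == x) + (b' / c' == x) + mup x f + mup x g)%N.
Proof.
move=> k0 c0 c'0 f0 g0; rewrite mupZ //.
have A0 := affine_neq0 b c0; have B0 := affine_neq0 b' c'0.
have AB0 := mulf_neq0 A0 B0.
by rewrite (mupM _ (mulf_neq0 AB0 f0) g0) (mupM _ AB0 f0) (mupM _ A0 B0) !mup_affine.
Qed.

(** Multiplicity of a root under a dilation of the variable. *)
Lemma mup_dilate (c x : F) (f : {poly F}) : c != 0 -> f != 0 ->
  mup x (f \Po (c *: 'X)) = mup (c * x) f.
Proof.
move=> c0 f0; have [m [g ng ->]] := multiplicity_XsubC f (c * x).
rewrite f0 /= in ng.
rewrite comp_polyM [in RHS]mupMr // mup_XsubCX eqxx.
have -> : ('X - (c * x)%:P) ^+ m \Po (c *: 'X) = (c ^+ m) *: ('X - x%:P) ^+ m.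
  rewrite rmorphXn /= comp_polyB comp_polyX comp_polyC -exprZn scalerBr.
  by congr ((_ - _) ^+ _); rewrite -mul_polyC polyCM.
rewrite mupMr ?mupZ ?expf_neq0 // ?mup_XsubCX ?eqxx //.
by rewrite /root horner_dilate.
Qed.

End Multiplicity.

Section Support.
Variables (F : fieldType) (q : F).
Hypothesis hq : generic_base q.
Let q0 := q_neq0 hq.

(** Since q is not a root of unity, there are infinitely many nonzero points. *)
Lemma poly_eq_nz (f g : {poly F}) : (forall z, z != 0 -> f.[z] = g.[z]) -> f = g.
Proof.
move=> h; apply/eqP; rewrite -subr_eq0; apply/eqP.
pose rs := [seq q ^+ n | n <- iota 0 (size (f - g))].
apply: (@roots_geq_poly_eq0 _ _ rs); last by rewrite size_map size_iota.
  apply/allP => x /mapP [n _ ->].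
  by rewrite /root hornerD hornerN h ?subrr // (qX_neq0 hq).
by rewrite map_inj_uniq ?iota_uniq //; exact: qX_inj.
Qed.

Lemma far_nonroot (f : {poly F}) (J : nat) : f != 0 -> exists2 j, (J <= j)%N & ~~ root f (q ^- j).
Proof.
move=> f0; pose rs := [seq q ^- n | n <- iota J (size f)].
have urs : uniq rs.
  rewrite map_inj_uniq ?iota_uniq // => m n /invr_inj; exact: qX_inj.
have : ~~ all (root f) rs.
  by apply/negP => ar; have := max_poly_roots f0 ar urs; rewrite size_map size_iota ltnn.
case/allPn => x /mapP [n]; rewrite mem_iota => /andP [leJ _] -> nr.
by exists n.
Qed.

Variables (a at' : F) (N Nt : nat) (eta : int) (p lam : {poly F}).
Hypothesis (a0 : a != 0) (at0 : at' != 0) (p0 : p != 0) (lam0 : lam != 0).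
Local Notation Y := (q ^ (- eta)).
Hypothesis ratio : forall z,
    at' * (q ^- N - z) * (1 - Y * (q^-1 * z)) * p.[q^-1 * z] * lam.[z]
    = a * (q ^- Nt - Y * z) * (1 - q^-1 * z) * p.[z] * lam.[q^-1 * z].

Let mu (f : {poly F}) (m : int) : nat := mup (q ^ m) f.

(** Multiplicities at q^m of both sides of [ratio].  The affine factors vanish at
    m = -N, 1 + eta, eta - Nt and 1. *)
Lemma mup_recurrence (m : int) :
  ((m == - N%:Z)%R + (m == 1 + eta)%R + mu p (m - 1)%R + mu lam m =
   (m == eta - Nt%:Z)%R + (m == 1)%R + mu p m + mu lam (m - 1)%R)%N.
Proof.
have qi0 : q^-1 != 0 by rewrite invr_eq0.
have Y0 : Y != 0 by exact: qXz_neq0.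
have Yq0 : Y / q != 0 by rewrite mulf_neq0.
have up0 (f : {poly F}) : f != 0 -> f \Po (q^-1 *: 'X) != 0.
  by move=> f0; rewrite -size_poly_eq0 size_dilate // size_poly_eq0.
have qm1 : q^-1 * q ^ m = q ^ (m - 1) by rewrite -exprN1 -expfzDr // addrC.
have eqq (b : F) (k : int) : b = q ^ k -> (b == q ^ m) = (m == k).
  by move=> ->; rewrite (inj_eq (qXz_inj hq)) eq_sym.
have E1 : (q ^- N / 1 == q ^ m) = (m == - N%:Z) by apply: eqq; rewrite divr1 exprnN.
have E2 : (1 / (Y / q) == q ^ m) = (m == 1 + eta).
  by apply: eqq; rewrite div1r invfM invrK invr_expz opprK addrC expfzDr ?expr1z.
have E3 : (q ^- Nt / Y == q ^ m) = (m == eta - Nt%:Z).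
  by apply: eqq; rewrite invr_expz opprK addrC expfzDr // -exprnN.
have E4 : (1 / q^-1 == q ^ m) = (m == 1) by apply: eqq; rewrite div1r invrK expr1z.
have e1 := mup_affine_prod (q ^- N) 1 (q ^ m) at0 (oner_neq0 F) Yq0 (up0 _ p0) lam0.
have e2 := mup_affine_prod (q ^- Nt) 1 (q ^ m) a0 Y0 qi0 p0 (up0 _ lam0).
rewrite (mup_dilate _ qi0 p0) qm1 E1 E2 in e1; rewrite (mup_dilate _ qi0 lam0) qm1 E3 E4 in e2.
rewrite -[LHS]e1 -[RHS]e2; congr (mup _ _).
apply: poly_eq_nz => z _; rewrite !(hornerZ, hornerM) !horner_dilate !(hornerD, hornerN, hornerZ,
  hornerC, hornerX).
by apply: etrans (etrans (ratio z) _); ring.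
Qed.

(** The difference of the multiplicities of p and lam at q^m is the difference of the
    indicator functions of the two grids, that is of -N <= m <= 0 and
    eta - Nt <= m <= eta. *)
Lemma support_roots (m : int) :
  (- N%:Z <= m <= 0 -> ~~ (eta - Nt%:Z <= m <= eta) -> root p (q ^ m)) /\
  (eta - Nt%:Z <= m <= eta -> ~~ (- N%:Z <= m <= 0) -> root lam (q ^ m)).
Proof.
have mu_root (f : {poly F}) k : f != 0 -> (0 < mu f k)%N -> root f (q ^ k).
  by move=> f0; rewrite /mu -XsubC_dvd // dvdp_XsubCl.
have mu_nroot (f : {poly F}) k : ~~ root f (q ^ k) -> mu f k = 0%N by exact: mupNroot.
(* The recurrence is solved from a point q^-j below all the affine roots at which
   neither p nor lam vanishes. *)
have [j lej] := far_nonroot (`|m|%N + `|eta|%N + N + Nt + 1)%N (mulf_neq0 p0 lam0).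
rewrite rootM negb_or exprnN => /andP [/mu_nroot p1 /mu_nroot l1].
have D k : (mu p (- j%:Z + k%:Z))%:Z - (mu lam (- j%:Z + k%:Z))%:Z =
  (- N%:Z <= - j%:Z + k%:Z :> int)%R%:Z + (1 + eta <= - j%:Z + k%:Z)%R%:Z
  - (eta - Nt%:Z <= - j%:Z + k%:Z)%R%:Z - (1 <= - j%:Z + k%:Z :> int)%R%:Z.
  elim: k => [|k IH]; first by rewrite addr0 p1 l1; lia.
  have := mup_recurrence (- j%:Z + k.+1%:Z).
  have -> : - j%:Z + k.+1%:Z - 1 = - j%:Z + k%:Z by lia.
  lia.
have {D} := D `|(m + j%:Z)%R|%N.
have -> : - j%:Z + `|(m + j%:Z)%R|%N%:Z = m by lia.
by move=> D; split=> h1 h2; apply: mu_root => //; lia.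
Qed.

End Support.

(** * Solving the equation for the ratio of weights *)
Section Classification.
Variables (F : fieldType) (q : F).
Hypothesis hq : generic_base q.
Let q0 := q_neq0 hq.
Let qX0 n : q ^+ n != 0 := qX_neq0 hq n.
Let q1 : 1 - q != 0. Proof. by have := qX_neq1 hq (ltn0Sn 0); rewrite expr1. Qed.

(** Lowest and highest coefficients of an identity between products of quadratic
    polynomials. *)
Lemma extreme_coef_eq (a b A0 A1 A2 B0 B1 B2 C0 C1 C2 D0 D1 D2 : F) :
  (forall z, a * (A0 + A1 * z + A2 * z ^+ 2) * (C0 + C1 * z + C2 * z ^+ 2)
           = b * (B0 + B1 * z + B2 * z ^+ 2) * (D0 + D1 * z + D2 * z ^+ 2)) ->
  a * A0 * C0 = b * B0 * D0 /\ a * A2 * C2 = b * B2 * D2.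
Proof.
move=> h; pose s := [:: a * A0 * C0 - b * B0 * D0;
  a * (A0 * C1 + A1 * C0) - b * (B0 * D1 + B1 * D0);
  a * (A0 * C2 + A1 * C1 + A2 * C0) - b * (B0 * D2 + B1 * D1 + B2 * D0);
  a * (A1 * C2 + A2 * C1) - b * (B1 * D2 + B2 * D1);
  a * A2 * C2 - b * B2 * D2].
have s0 : Poly s = 0.
  apply: (poly_eq_nz hq) => z _; rewrite horner0 horner_Poly /= mul0r add0r.
  by have := h z => /eqP; rewrite -subr_eq0 => /eqP <-; ring.
split; apply/eqP; rewrite -subr_eq0.
  by have := coef_Poly s 0; rewrite s0 coef0 /= => <-.
by have := coef_Poly s 4; rewrite s0 coef0 /= => <-.
Qed.

Lemma distinct_roots (p : {poly F}) (s : seq int) : p != 0 -> uniq s ->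
  (size p <= size s)%N -> ~ (forall m, m \in s -> root p (q ^ m)).
Proof.
move=> p0 us sp h; have ar : all (root p) [seq q ^ m | m <- s].
  by apply/allP => x /mapP [m ms ->]; exact: h.
have := max_poly_roots p0 ar; rewrite size_map (map_inj_uniq (qXz_inj hq)) ltnNge sp.
by move/(_ us).
Qed.

Variables (a at' : F) (N Nt : nat) (eta : int).
Hypothesis ha : generic_param q (QKParam a N).
Hypothesis hat : generic_param q (QKParam at' Nt).
Hypothesis (N20 : (20 <= N)%N) (Nt20 : (20 <= Nt)%N).
Let a0 : a != 0. Proof. by case: ha. Qed.
Let at0 : at' != 0. Proof. by case: hat. Qed.

Local Notation rho := (QKParam a N).
Local Notation rhot := (QKParam at' Nt).
Local Notation Lt := (shifted_qKfun q at' Nt eta).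
Local Notation Y := (q ^ (- eta)).
Let Y0 : Y != 0. Proof. exact: qXz_neq0. Qed.

Let uq2 : q ^- N - q ^+ 2 != 0.
Proof. by rewrite subr_eq0 exprnN exprnP (inj_eq (qXz_inj hq)); lia. Qed.

Lemma horner_size2 (p : {poly F}) z : (size p <= 2)%N -> p.[z] = p`_0 + p`_1 * z.
Proof. by move=> sp; rewrite (horner_coef_wide _ sp) !big_ord_recl big_ord0 /= expr0 expr1 addr0
  mulr1. Qed.

Lemma horner_size3 (p : {poly F}) z : (size p <= 3)%N -> p.[z] = p`_0 + p`_1 * z + p`_2 * z ^+ 2.
Proof. by move=> sp; rewrite (horner_coef_wide _ sp) !big_ord_recl big_ord0 /= expr0 expr1 addr0
  mulr1 addrA. Qed.

Lemma root_size2 (p : {poly F}) (m : int) : p != 0 -> (size p <= 2)%N -> root p (q ^ m) ->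
  [/\ p`_0 != 0, p`_1 != 0 & p`_0 = - (p`_1 * q ^ m)].
Proof.
move=> p0 sp; rewrite /root horner_size2 // addr_eq0 => /eqP e.
have p1 : p`_1 != 0.
  apply: contra p0 => /eqP p1; rewrite -size_poly_leq0; apply/leq_sizeP => j _.
  case: j => [|[|j]]; rewrite ?p1 ?e ?p1 ?mul0r ?oppr0 //.
  by rewrite nth_default // (leq_trans sp).
by rewrite e oppr_eq0 mulf_neq0 ?(qXz_neq0 hq).
Qed.

(** The multipliers and parameters allowed for type B_2.  The index o1 stands for the
    relation that leads from rho to the intermediate parameters, and o2 for the one that
    leads there from rhot. *)
Lemma B2_classify (lam : {poly F}) : lam != 0 -> (size lam <= 2)%N ->
  (forall i, (1 < i <= 10)%N -> Lt (fun z => lam.[z] * (qKpoly q a N i).[z]) = 0) ->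
  (eta = 0 /\ rhot = rho) \/
  exists o1 o2, [/\ o1 <> o2, eta = oqK_eta o1 - oqK_eta o2,
    oqK_bar q o1 rho = oqK_bar q o2 rhot &
    exists2 k, k != 0 & forall z, lam.[z] = k * oqK_lamm q o2 rhot (Y * z)].
Proof.
move=> lam0 sl hlam.
have sd : (size lam + 1 <= 3)%N by lia.
have [p [p0 sp ratio]] := weight_ratio hq ha hat lam0 sd N20 Nt20 hlam.
have supp := support_roots hq a0 at0 p0 lam0 ratio.
have hS m m' : - N%:Z <= m <= 0 -> ~~ (eta - Nt%:Z <= m <= eta) ->
    - N%:Z <= m' <= 0 -> ~~ (eta - Nt%:Z <= m' <= eta) -> m = m'.
  move=> h1 h2 h3 h4; apply/eqP/negPn/negP => ne.
  apply: (@distinct_roots p [:: m; m']) => //; first by rewrite /= inE ne.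
  by move=> l; rewrite !inE => /orP [] /eqP ->; apply: (supp _).1.
have hS' m m' : eta - Nt%:Z <= m <= eta -> ~~ (- N%:Z <= m <= 0) ->
    eta - Nt%:Z <= m' <= eta -> ~~ (- N%:Z <= m' <= 0) -> m = m'.
  move=> h1 h2 h3 h4; apply/eqP/negPn/negP => ne.
  apply: (@distinct_roots lam [:: m; m']) => //; first by rewrite /= inE ne.
  by move=> l; rewrite !inE => /orP [] /eqP ->; apply: (supp _).2.
have cases : [\/ eta = 0 /\ Nt = N, eta = 0 /\ Nt.+1 = N, eta = -1 /\ Nt.+1 = N |
   [\/ eta = 0 /\ Nt = N.+1, eta = 1 /\ Nt = N.+1, eta = 1 /\ Nt = N | eta = -1 /\ Nt = N]].
  have h1 := hS 0 (-1); have h2 := hS (- N%:Z) (- N%:Z + 1); have h3 := hS 0 (- N%:Z).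
  have h4 := hS' eta (eta - 1); have h5 := hS' (eta - Nt%:Z) (eta - Nt%:Z + 1);
    have h6 := hS' eta (eta - Nt%:Z).
  have e1 : -1 <= eta <= 1 by lia.
  have e2 : -1 <= Nt%:Z - eta - N%:Z <= 1 by lia.
  have : [|| eta == -1, eta == 0 | eta == 1] by lia.
  case/or3P => /eqP ee.
  - have [?|?] : Nt.+1 = N \/ Nt = N by lia.
      by constructor 3.
    by constructor 4; constructor 4.
  - have [?|[?|?]] : Nt = N \/ Nt.+1 = N \/ Nt = N.+1 by lia.
    + by constructor 1.
    + by constructor 2.
    + by constructor 4; constructor 1.
  - have [?|?] : Nt = N \/ Nt = N.+1 by lia.
      by constructor 4; constructor 3.
    by constructor 4; constructor 2.
have [bot top] : at' * q ^- N * (p`_0 * lam`_0) = a * q ^- Nt * (p`_0 * lam`_0) /\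
    at' * (Y / q) * (p`_1 * lam`_1 / q) = a * (Y / q) * (p`_1 * lam`_1 / q).
  apply: (@extreme_coef_eq _ _ _ (- (1 + q ^- N * (Y / q))) _ _ (- (Y + q ^- Nt / q)) _
      _ (p`_0 * lam`_1 + p`_1 / q * lam`_0) _ _ (p`_1 * lam`_0 + p`_0 * lam`_1 / q) _) => z.
  have := ratio z; rewrite !horner_size2 // => e.
  by apply: etrans (etrans e _); ring.
(* The highest coefficient compares at' with a, the lowest at' q^Nt with a q^N. *)
have topE : p`_1 != 0 -> lam`_1 != 0 -> at' = a.
  move=> p1 l1; have w0 : (Y / q) * (p`_1 * lam`_1 / q) != 0 by rewrite !mulf_neq0 ?invr_eq0.
  by apply: (mulIf w0); rewrite !mulrA in top *.
have botE : p`_0 != 0 -> lam`_0 != 0 -> at' * q ^+ Nt = a * q ^+ N.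
  move=> p1 l1; have w0 := mulf_neq0 p1 l1; have := mulIf w0 bot.
  move=> /(congr1 (fun x => x * q ^+ N * q ^+ Nt)).
  by rewrite divfK // mulrAC divfK // [a * _ * _]mulrAC => <-.
have nz2 (f : {poly F}) : f != 0 -> (size f <= 2)%N -> f`_0 = 0 -> f`_1 != 0.
  move=> f0 sf e0; apply: contra f0 => /eqP e1; rewrite -size_poly_leq0; apply/leq_sizeP => j _.
  by case: j => [|[|j]] //; rewrite nth_default // (leq_trans sf).
have lamE z := horner_size2 z sl.
case: cases => [[ee eN]|[ee eN]|[ee eN]|[[ee eN]|[ee eN]|[ee eN]|[ee eN]]].
- have [e|ne] := eqVneq at' a; [by left; split; rewrite // eN e | right].
  (* When p = c z, lam = c' or p = c, lam = c' z, the extreme coefficients say nothing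
     about at'; the identity is then used at z = q^2, where the other factors are
     nonzero. *)
  have ratio2 : at' * p.[q] * lam.[q ^+ 2] = a * p.[q ^+ 2] * lam.[q].
    have := ratio (q ^+ 2); rewrite ee eN oppr0 expr0z !mul1r expr2 mulKf // -expr2 => e.
    by apply: (mulfI (mulf_neq0 uq2 q1)); apply: etrans (etrans e _); ring.
  move: ratio2; rewrite !horner_size2 //.
  have [p00|p00] := eqVneq p`_0 0.
    have p1 := nz2 _ p0 sp p00.
    have l1 : lam`_1 = 0 by apply/eqP/negPn/negP => /(topE p1) e; rewrite e eqxx in ne.
    have l0 : lam`_0 != 0.
      by apply/eqP => /(nz2 _ lam0 sl); rewrite l1 eqxx.
    rewrite p00 l1 !mul0r !add0r !addr0 => e.
    have ea : at' = q * a.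
      have w0 : p`_1 * q * lam`_0 != 0 by rewrite !mulf_neq0.
      by apply: (mulIf w0); apply: etrans (etrans e _); ring.
    exists (Some qKI), None; split => //; first by rewrite /= eN ea.
    by exists lam`_0 => // z; rewrite lamE l1 mul0r addr0 /= mulr1.
  have l0 : lam`_0 = 0.
    apply/eqP/negPn/negP => /(botE p00); rewrite eN => /(mulIf (qX0 N)) e.
    by rewrite e eqxx in ne.
  have l1 := nz2 _ lam0 sl l0.
  have p1 : p`_1 = 0 by apply/eqP/negPn/negP => /topE /(_ l1) e; rewrite e eqxx in ne.
  rewrite p1 l0 !mul0r !add0r !addr0 => e.
  have ea : a = q * at'.
    have w0 : p`_0 * lam`_1 * q != 0 by rewrite !mulf_neq0.
    by apply: (mulIf w0); apply/esym; apply: etrans (etrans e _); ring.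
  exists None, (Some qKI); split => //; first by rewrite /= eN ea.
  exists (lam`_1 / q ^+ Nt); first by rewrite mulf_neq0 ?invr_eq0.
  by move=> z; rewrite lamE l0 add0r /= ee oppr0 expr0z mul1r mulrA divfK.
- have rp : root p (q ^ (- N%:Z)) by apply: (supp (- N%:Z)).1; clear -ee eN N20 Nt20; lia.
  have [p00 p1 _] := root_size2 p0 sp rp; right.
  have [l0|l0] := eqVneq lam`_0 0.
    have l1 := nz2 _ lam0 sl l0; have ea := topE p1 l1.
    exists (Some qKII), (Some qKI); split => //; first by rewrite /= -eN ea.
    exists (lam`_1 / q ^+ Nt); first by rewrite mulf_neq0 ?invr_eq0.
    by move=> z; rewrite lamE l0 add0r /= ee oppr0 expr0z mul1r mulrA divfK.
  have ea : at' = q * a by apply: (mulIf (qX0 Nt)); rewrite botE // -eN exprS; ring.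
  have l1 : lam`_1 = 0.
    apply/eqP/negPn/negP => /(topE p1); rewrite ea -{2}[a]mul1r => /(mulIf a0)/eqP.
    by rewrite -subr_eq0 -opprB oppr_eq0 (negbTE q1).
  exists (Some qKII), None; split => //; first by rewrite /= -eN ea.
  by exists lam`_0 => // z; rewrite lamE l1 mul0r addr0 /= mulr1.
- have rp : root p (q ^ 0) by apply: (supp 0).1; clear -ee eN N20 Nt20; lia.
  have [p00 p1 _] := root_size2 p0 sp rp; right.
  have [l0|l0] := eqVneq lam`_0 0.
    have l1 := nz2 _ lam0 sl l0; have ea := topE p1 l1.
    exists (Some qKIII), (Some qKI); split => //; first by rewrite /= -eN ea.
    exists (lam`_1 / q ^+ Nt / q); first by rewrite !mulf_neq0 ?invr_eq0.
    by move=> z; rewrite lamE l0 add0r /= ee opprK expr1z; fld.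
  have ea : at' = q * a by apply: (mulIf (qX0 Nt)); rewrite botE // -eN exprS; ring.
  have l1 : lam`_1 = 0.
    apply/eqP/negPn/negP => /(topE p1); rewrite ea -{2}[a]mul1r => /(mulIf a0)/eqP.
    by rewrite -subr_eq0 -opprB oppr_eq0 (negbTE q1).
  exists (Some qKIII), None; split => //; first by rewrite /= -eN ea.
  by exists lam`_0 => // z; rewrite lamE l1 mul0r addr0 /= mulr1.
- have rl : root lam (q ^ (- Nt%:Z)) by apply: (supp (- Nt%:Z)).2; clear -ee eN N20 Nt20; lia.
  have [l0 l1 el] := root_size2 lam0 sl rl; right.
  have D : 1 - q ^+ Nt != 0 by apply: (qX_neq1 hq); clear -Nt20; lia.
  have lk : exists2 k, k != 0 & forall z, lam.[z] = k * oqK_lamm q (Some qKII) rhot (Y * z).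
    exists (lam`_0 * (1 - q ^+ Nt)); first exact: mulf_neq0.
    by move=> z; rewrite lamE el -exprnN /= ee oppr0 expr0z mul1r; fld.
  have [p00|p00] := eqVneq p`_0 0.
    have p1 := nz2 _ p0 sp p00; have ea := topE p1 l1.
    by exists (Some qKI), (Some qKII); split; rewrite //= ?ee // eN ea.
  have ea : a = q * at' by apply: (mulIf (qX0 N)); rewrite -botE // eN exprS; ring.
  by exists None, (Some qKII); split; rewrite //= ?ee // eN ea.
- have rl : root lam (q ^ 1) by apply: (supp 1).2; clear -ee eN N20 Nt20; lia.
  have [l0 l1 el] := root_size2 lam0 sl rl; right.
  have D : 1 - q ^+ Nt != 0 by apply: (qX_neq1 hq); clear -Nt20; lia.
  have lk : exists2 k, k != 0 & forall z, lam.[z] = k * oqK_lamm q (Some qKIII) rhot (Y * z).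
    exists (lam`_0 * (1 - q ^+ Nt)); first exact: mulf_neq0.
    by move=> z; rewrite lamE el expr1z /= ee exprN1; fld.
  have [p00|p00] := eqVneq p`_0 0.
    have p1 := nz2 _ p0 sp p00; have ea := topE p1 l1.
    by exists (Some qKI), (Some qKIII); split; rewrite //= ?ee // eN ea.
  have ea : a = q * at' by apply: (mulIf (qX0 N)); rewrite -botE // eN exprS; ring.
  by exists None, (Some qKIII); split; rewrite //= ?ee // eN ea.
- have rp : root p (q ^ (- N%:Z)) by apply: (supp (- N%:Z)).1; clear -ee eN N20 Nt20; lia.
  have [p00 p1 _] := root_size2 p0 sp rp.
  have rl : root lam (q ^ 1) by apply: (supp 1).2; clear -ee eN N20 Nt20; lia.
  have [l0 l1 el] := root_size2 lam0 sl rl; right.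
  have D : 1 - q ^+ Nt != 0 by apply: (qX_neq1 hq); clear -Nt20; lia.
  have ea := topE p1 l1; exists (Some qKII), (Some qKIII); split; rewrite //= ?ee // ?eN ?ea //.
  exists (lam`_0 * (1 - q ^+ Nt)); first exact: mulf_neq0.
  by move=> z; rewrite lamE el expr1z /= exprN1 -eN; fld.
- have rp : root p (q ^ 0) by apply: (supp 0).1; clear -ee eN N20 Nt20; lia.
  have [p00 p1 _] := root_size2 p0 sp rp.
  have rl : root lam (q ^ (- (Nt.+1)%:Z)) by apply: (supp (- (Nt.+1)%:Z)).2;
    clear -ee eN N20 Nt20; lia.
  have [l0 l1 el] := root_size2 lam0 sl rl; right.
  have D : 1 - q ^+ Nt != 0 by apply: (qX_neq1 hq); clear -Nt20; lia.
  have ea := topE p1 l1; exists (Some qKIII), (Some qKII); split; rewrite //= ?ee // ?eN ?ea //.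
  exists (lam`_0 * (1 - q ^+ Nt)); first exact: mulf_neq0.
  by move=> z; rewrite lamE el -exprnN exprS /= opprK expr1z -eN; fld.
Qed.

(** The parameters allowed for type B'_2, where the multiplier is a constant. *)
Lemma B2'_classify (l0 : F) : l0 != 0 ->
  (forall i, (2 < i <= 10)%N -> Lt (fun z => l0%:P.[z] * (qKpoly q a N i).[z]) = 0) ->
  exists o1 o2, eta = oqK_eta o1 + oqK_eta o2 /\ rhot = oqK_bar q o2 (oqK_bar q o1 rho).
Proof.
move=> l00 hlam; pose lam := l0%:P : {poly F}.
have lam0 : lam != 0 by rewrite polyC_eq0.
have sl : (size lam + 2 <= 3)%N by rewrite size_polyC l00.
have [p [p0 sp ratio]] := weight_ratio hq ha hat lam0 sl N20 Nt20 hlam.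
have lamE z : lam.[z] = l0 by rewrite hornerC.
have supp := support_roots hq a0 at0 p0 lam0 ratio.
have hS m m' m'' : - N%:Z <= m <= 0 -> ~~ (eta - Nt%:Z <= m <= eta) ->
    - N%:Z <= m' <= 0 -> ~~ (eta - Nt%:Z <= m' <= eta) ->
    - N%:Z <= m'' <= 0 -> ~~ (eta - Nt%:Z <= m'' <= eta) -> [|| m == m', m == m'' | m' == m''].
  move=> h1 h2 h3 h4 h5 h6; apply/negPn/negP; rewrite !negb_or => /and3P [n1 n2 n3].
  apply: (@distinct_roots p [:: m; m'; m'']) => //; first by rewrite /= !inE negb_or n1 n2 n3.
  by move=> l; rewrite !inE => /or3P [] /eqP ->; apply: (supp _).1.
have hS' m : eta - Nt%:Z <= m <= eta -> ~~ (- N%:Z <= m <= 0) -> False.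
  by move=> h1 h2; have /rootP := (supp m).2 h1 h2; rewrite lamE => /eqP; rewrite (negbTE l00).
have ext : -2 <= eta <= 0 /\ (N%:Z - 2 <= Nt%:Z <= N%:Z + eta).
  have h1 := hS 0 (-1) (-2); have h2 := hS (- N%:Z) (- N%:Z + 1) (- N%:Z + 2).
  have h3 := hS 0 (- N%:Z) (-1); have h3' := hS 0 (- N%:Z) (- N%:Z + 1).
  have h4 := hS' eta; have h5 := hS' (eta - Nt%:Z).
  by clear -h1 h2 h3 h3' h4 h5 N20 Nt20; lia.
have [bot top] : at' * q ^- N * (p`_0 * l0) = a * q ^- Nt * (p`_0 * l0) /\
    at' * (Y / q) * (p`_2 / q ^+ 2 * l0) = a * (Y / q) * (p`_2 * l0).
  apply: (@extreme_coef_eq _ _ _ (- (1 + q ^- N * (Y / q))) _ _ (- (Y + q ^- Nt / q)) _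
      _ (p`_1 / q * l0) _ _ (p`_1 * l0) _) => z.
  have := ratio z; rewrite !(horner_size3 _ sp) !lamE => e.
  apply: etrans (etrans e _); last by ring.
  by fld.
(* The highest coefficient compares at' with a q^2, the lowest at' q^Nt with a q^N. *)
have topE : p`_2 != 0 -> at' = q * (q * a).
  move=> p2; have w0 : (Y / q) * (p`_2 / q ^+ 2 * l0) != 0 by rewrite !mulf_neq0 ?invr_eq0
    ?expf_neq0.
  by apply: (mulIf w0); rewrite [LHS]mulrA top; fld.
have botE : p`_0 != 0 -> at' * q ^+ Nt = a * q ^+ N.
  move=> p1; have w0 := mulf_neq0 p1 l00; have := mulIf w0 bot.
  move=> /(congr1 (fun x => x * q ^+ N * q ^+ Nt)).
  by rewrite divfK // mulrAC divfK // [a * _ * _]mulrAC => <-.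
have pE z := horner_size3 z sp.
have pnz : p`_0 = 0 -> p`_2 = 0 -> p`_1 != 0.
  move=> e0 e2; apply: contra p0 => /eqP e1; rewrite -size_poly_leq0; apply/leq_sizeP => j _.
  by case: j => [|[|[|j]]] //; rewrite nth_default // (leq_trans sp).
(* A monomial in z has no root among the powers of q. *)
have pmono m : - N%:Z <= m <= 0 -> ~~ (eta - Nt%:Z <= m <= eta) -> p`_0 = 0 -> p`_2 = 0 -> False.
  move=> h1 h2 e0 e2; have /rootP := (supp m).1 h1 h2; rewrite pE e0 e2 mul0r add0r addr0 => /eqP.
  by rewrite mulf_eq0 (negbTE (pnz e0 e2)) (negbTE (qXz_neq0 hq _)).
have p2roots m m' : - N%:Z <= m <= 0 -> ~~ (eta - Nt%:Z <= m <= eta) ->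
    - N%:Z <= m' <= 0 -> ~~ (eta - Nt%:Z <= m' <= eta) -> m != m' -> p`_0 != 0.
  move=> h1 h2 h3 h4 ne; apply/eqP => e0.
  have r0 : root p 0 by apply/rootP; rewrite pE e0; ring.
  have := max_poly_roots (rs := [:: 0; q ^ m; q ^ m']) p0.
  rewrite /= r0 (supp m).1 // (supp m').1 // !inE negb_or ![0 == _]eq_sym !(negbTE (qXz_neq0 hq _)).
  by rewrite (inj_eq (qXz_inj hq)) ne => /(_ isT isT); rewrite ltnNge sp.
have one m r : - N%:Z <= m <= 0 -> ~~ (eta - Nt%:Z <= m <= eta) -> Nt.+1 = N -> lowers r -> eta =
  oqK_eta r ->
  exists o1 o2, eta = oqK_eta o1 + oqK_eta o2 /\ rhot = oqK_bar q o2 (oqK_bar q o1 rho).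
  move=> h1 h2 eN lr er; have [p00|p00] := eqVneq p`_0 0.
    have p2 : p`_2 != 0 by apply/eqP; exact: pmono h1 h2 p00.
    exists (Some qKI), r; split; first by rewrite er /= add0r.
    by rewrite (topE p2); case: r lr {er} => [[]|] //= _; rewrite -eN.
  have ea : at' = q * a by apply: (mulIf (qX0 Nt)); rewrite botE // -eN exprS; ring.
  exists r, None; split; first by rewrite er addr0.
  by rewrite ea; case: r lr {er} => [[]|] //= _; rewrite -eN.
have two m m' r r' : - N%:Z <= m <= 0 -> ~~ (eta - Nt%:Z <= m <= eta) ->
    - N%:Z <= m' <= 0 -> ~~ (eta - Nt%:Z <= m' <= eta) -> m != m' ->
   Nt.+2 = N -> lowers r -> lowers r' -> eta = oqK_eta r + oqK_eta r' ->
  exists o1 o2, eta = oqK_eta o1 + oqK_eta o2 /\ rhot = oqK_bar q o2 (oqK_bar q o1 rho).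
  move=> h1 h2 h3 h4 ne eN lr lr' er; have p00 := p2roots _ _ h1 h2 h3 h4 ne.
  have ea : at' = q * (q * a) by apply: (mulIf (qX0 Nt)); rewrite botE // -eN !exprS; ring.
  exists r, r'; split => //; rewrite ea.
  by case: r lr {er} => [[]|] //= _; case: r' lr' => [[]|] //= _; rewrite -eN.
have : [|| (eta == 0) && (Nt == N), (eta == 0) && (Nt.+1 == N), (eta == -1) && (Nt.+1 == N),
   (eta == 0) && (Nt.+2 == N), (eta == -1) && (Nt.+2 == N) | (eta == -2) && (Nt.+2 == N)].
  by clear -ext; lia.
case/or4P => [/andP[/eqP ee /eqP eN]|/andP[/eqP ee /eqP eN]|/andP[/eqP ee /eqP eN]|/or3P []
  /andP[/eqP ee /eqP eN]].
- have [p00|p00] := eqVneq p`_0 0; last first.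
    have ea : at' = a by apply: (mulIf (qX0 Nt)); rewrite botE // eN.
    by exists None, None; rewrite /= ea eN.
  have [p20|p20] := eqVneq p`_2 0; last first.
    by exists (Some qKI), (Some qKI); rewrite /= (topE p20) eN.
  exists (Some qKI), None; split=> //=; rewrite eN; congr QKParam.
  have p1 := pnz p00 p20.
  (* Here p is a monomial of degree 1; the other factors are nonzero at z = q^2. *)
  have := ratio (q ^+ 2); rewrite ee eN oppr0 expr0z !mul1r expr2 mulKf // -expr2 !pE p00 p20
    !lamE => e.
  apply: (mulIf (mulf_neq0 (mulf_neq0 uq2 q1) (mulf_neq0 (mulf_neq0 p1 l00) q0))).
  by apply: etrans (etrans e _); ring.
- by apply: (one (- N%:Z) (Some qKII)) => //; clear -ee eN N20 Nt20; lia.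
- by apply: (one 0 (Some qKIII)) => //; clear -ee eN N20 Nt20; lia.
- by apply: (two (- N%:Z) (- N%:Z + 1) (Some qKII) (Some qKII)) => //; clear -ee eN N20 Nt20; lia.
- by apply: (two (- N%:Z) 0 (Some qKII) (Some qKIII)) => //; clear -ee eN N20 Nt20; lia.
- by apply: (two (-1) 0 (Some qKIII) (Some qKIII)) => //; clear -ee eN N20 Nt20; lia.
Qed.

End Classification.

(** * Uniqueness of the coefficients of an expansion *)
Section Expansions.
Variables (F : fieldType) (q : F).
Hypothesis hq : generic_base q.
Let q0 := q_neq0 hq.
Let qz0 (m : int) : q ^ m != 0 := qXz_neq0 hq m.

Lemma expansion_lin rho rhot eta eps lam1 lam2 Phi1 Phi2 (k1 k2 : F) :
  expansion q rho rhot eta eps lam1 Phi1 -> expansion q rho rhot eta eps lam2 Phi2 ->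
  expansion q rho rhot eta eps (fun z => k1 * lam1 z + k2 * lam2 z)
    (fun e i => k1 * Phi1 e i + k2 * Phi2 e i).
Proof.
move=> h1 h2 i lei; have [z1 e1] := h1 i lei; have [z2 e2] := h2 i lei.
split=> [e ee he|z z0 hz]; first by rewrite z1 ?z2 // !mulr0 addr0.
rewrite mulrDl -!mulrA e1 // e2 // !mulr_sumr -big_split; apply: eq_bigr => e _ /=.
by rewrite mulrDl !mulrA.
Qed.

Lemma expansion_scale rho rhot eta eps lam Phi (k : F) :
  expansion q rho rhot eta eps lam Phi ->
  expansion q rho rhot eta eps (fun z => k * lam z) (fun e i => k * Phi e i).
Proof.
move=> h1 i lei; have [z1 e1] := h1 i lei.
split=> [e ee he|z z0 hz]; first by rewrite z1 // mulr0.
by rewrite -!mulrA e1 // !mulr_sumr; apply: eq_bigr => e _ /=; rewrite mulrA.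
Qed.

Lemma expansion_eq_lam rho rhot eta eps lam lam' Phi :
  (forall z, z != 0 -> lam z = lam' z) ->
  expansion q rho rhot eta eps lam Phi -> expansion q rho rhot eta eps lam' Phi.
Proof.
move=> e h1 i lei; have [z1 e1] := h1 i lei.
by split=> // z z0 hz; rewrite -e // e1.
Qed.

(** Offsets may be added with coefficient zero. *)
Lemma expansion_pad rho rhot eta eps eps' lam Phi :
  uniq eps -> uniq eps' -> {subset eps <= eps'} ->
  expansion q rho rhot eta eps lam Phi ->
  expansion q rho rhot eta eps' lam (fun e i => if e \in eps then Phi e i else 0).
Proof.
move=> ue ue' sub /(@expansionP F q) h; apply/(@expansionP F q) => i lei.
have [z1 e1] := h i lei; split=> [e ee he|z z0 hz].
  by case: ifP => // ein; apply: z1.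
rewrite e1 //; last first.
  by case: hz => [hz|hz]; [left=> e ein; apply: hz; exact: sub | right].
rewrite [RHS](bigID (mem eps)) /= [X in _ + X]big1 ?addr0 => [|e /negbTE ->]; last by rewrite mul0r.
rewrite -[RHS]big_filter.
have pe : perm_eq [seq e <- eps' | e \in eps] eps.
  apply: uniq_perm => //; first exact: filter_uniq.
  by move=> e; rewrite mem_filter; case: (boolP (e \in eps)) => // /sub ->.
rewrite [RHS](perm_big _ pe) /= big_seq [RHS]big_seq; apply: eq_bigr => e ->.
by [].
Qed.

Lemma on_gridP N (n : int) : on_grid q N (q ^ (- n)) <-> 0 <= n <= N%:Z.
Proof.
split=> [[m lem]|/andP [n0 nN]].
  by rewrite exprnN => /(qXz_inj hq); lia.
by exists `|n|%N; rewrite ?exprnN; [lia | congr (_ ^ _); lia].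
Qed.

Section Pair.
Variables (a at' : F) (N Nt : nat) (eta : int).
Hypothesis ha : generic_param q (QKParam a N).
Hypothesis hat : generic_param q (QKParam at' Nt).
Local Notation rho := (QKParam a N).
Local Notation rhot := (QKParam at' Nt).
Local Notation Lt := (shifted_qKfun q at' Nt eta).
Local Notation Y := (q ^ (- eta)).

Lemma qKext_poly j z : in_range Nt j -> qKext q rhot j z = (qKpoly q at' Nt `|j|).[z].
Proof. by move=> hj; rewrite /qKext /= hj (qKpolyE hq). Qed.

Lemma qKfun_ext j : 1 <= j <= Nt%:Z -> qKfun q at' Nt (qKext q rhot j) = 0.
Proof.
move=> hj; rewrite (@eq_qKfun _ _ _ _ _ (fun z => (qKpoly q at' Nt `|j|).[z])).
  by rewrite (qKfun_qKpoly hq hat) //; lia.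
by move=> z; rewrite qKext_poly // /in_range; lia.
Qed.

(** The functional of the right-hand side kills an expansion whose indices i + e are all
    positive. *)
Lemma expansion_orthogonal eps lam Phi i :
  expansion q rho rhot eta eps lam Phi -> (i <= N)%N ->
  (forall e, e \in eps -> 1 <= i%:Z + e <= Nt%:Z) ->
  Lt (fun z => lam z * qKrawtchouk q rho i z) = 0.
Proof.
move=> /(@expansionP F q) h lei he; have [_ e1] := h i lei.
transitivity (qKfun q at' Nt (fun z => \sum_(e <- eps) Phi e i * qKext q rhot (i%:Z + e) z)).
  apply: eq_bigr => x _; congr (_ * _); rewrite e1.
  - by apply: eq_bigr => e _; rewrite mulrA YeK // mul1r.
  - by rewrite mulf_neq0 // exprnN.
  - by left=> e /he /=; lia.
rewrite /qKfun; under eq_bigr => x _ do rewrite mulr_sumr.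
rewrite exchange_big big_seq big1 //= => e ee.
under eq_bigr => x _ do rewrite mulrCA.
by rewrite -mulr_sumr -/(qKfun q at' Nt (qKext q rhot (i%:Z + e))) qKfun_ext ?mulr0 //; exact: he.
Qed.

(** The multiplier determines the coefficients, provided that at most one point x0 of
    the grid of the right-hand side is not in the grid of the left-hand side. *)
Lemma expansion_unique (eps : seq int) lam Phi Phi' (x0 : nat) :
  uniq eps -> (forall e : int, e \in eps -> -2 <= e <= 1) -> (3 <= Nt)%N ->
  (x0 <= Nt)%N -> (forall n : nat, (n <= Nt)%N -> n <> x0 -> 0 <= n%:Z - eta <= N%:Z) ->
  expansion q rho rhot eta eps lam Phi -> expansion q rho rhot eta eps lam Phi' ->
  forall (e : int) i, e \in eps -> (i <= N)%N -> Phi e i = Phi' e i.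
Proof.
move=> ue be Nt3 lex0 hx0 /(@expansionP F q) h1 /(@expansionP F q) h2 e0 i ee0 lei.
have [z1 e1] := h1 i lei; have [z2 e2] := h2 i lei.
have [ir|nir] := boolP (in_range Nt (i%:Z + e0)); last by rewrite z1 ?z2.
pose D e := Phi e i - Phi' e i.
pose f : {poly F} := \sum_(e <- eps | in_range Nt (i%:Z + e)) D e *: qKpoly q at' Nt `|(i%:Z +
  e)%R|.
have fE z : z != 0 -> expansion_domain q rho rhot eta eps i (q ^ eta * z) -> f.[z] = 0.
  move=> nz hz; have w0 : q ^ eta * z != 0 by rewrite mulf_neq0.
  have := e1 _ w0 hz; rewrite e2 // => /esym/eqP; rewrite -subr_eq0 -sumrB => /eqP e12.
  rewrite -[RHS]e12.
  rewrite horner_sum big_mkcond; apply: eq_bigr => e _.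
  rewrite hornerZ -mulrBl mulrA YeK // mul1r; case: ifP => [hr|hr]; first by rewrite qKext_poly.
  by rewrite qKext_out ?mulr0 //= hr.
have szf : (size f <= Nt.+1)%N.
  rewrite (leq_trans (size_sum _ _ _)) //; apply/bigmax_leqP_seq => e _ hr.
  rewrite (leq_trans (size_scale_leq _ _)) // (size_qKpoly hq hat) //; move: hr;
    rewrite /in_range; lia.
have f0 : f = 0.
  have [hA|/allPn [e' ee' he']] := boolP (all (fun e => i%:Z + e <= Nt%:Z) eps).
    apply: (poly_eq_nz hq) => z z0; rewrite fE ?horner0 //.
    by left=> e ee; exact: (allP hA).
  have bi e : e \in eps -> 1 <= i%:Z + e.
    by move=> /be; have := be _ ee'; lia.
  have off (n : nat) : (n <= Nt)%N -> n <> x0 -> f.[q ^- n] = 0.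
    move=> len nx; apply: fE; first by rewrite invr_eq0 (qX_neq0 hq).
    right; rewrite exprnN -expfzDr //; split.
      have -> : eta - n%:Z = - (n%:Z - eta) by lia.
      by apply/on_gridP; apply: hx0.
    by rewrite -expfzDr // addrA addNr add0r; apply/on_gridP => /=; lia.
  (* All terms of f have positive index, so L' f = 0, and only x0 contributes to it. *)
  have on : f.[q ^- x0] = 0.
    have : qKfun q at' Nt (fun z => f.[z]) = 0.
      rewrite (@eq_qKfun _ _ _ _ _ (fun z => \sum_(e <- eps) (if in_range Nt (i%:Z + e) then D e
        else 0) * qKext q rhot (i%:Z + e) z)); last first.
        move=> z; rewrite horner_sum big_mkcond; apply: eq_bigr => e _; case: ifP => hr;
          last by rewrite mul0r.
        by rewrite hornerZ qKext_poly.
      rewrite /qKfun; under eq_bigr => x _ do rewrite mulr_sumr.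
      rewrite exchange_big big_seq big1 //= => e ee.
      under eq_bigr => x _ do rewrite mulrCA.
      rewrite -mulr_sumr -/(qKfun q at' Nt (qKext q rhot (i%:Z + e))).
      case: ifP => [hr|]; last by rewrite mul0r.
      by rewrite qKfun_ext ?mulr0 //; move: hr (bi _ ee); rewrite /in_range; lia.
    rewrite /qKfun (bigD1 (Ordinal (lex0 : (x0 < Nt.+1)%N))) //= big1 ?addr0 => [/eqP|x ne].
      by rewrite mulf_eq0 (negbTE (qKweight_neq0 hq hat lex0)) => /eqP.
    rewrite off ?mulr0 //; first by rewrite -ltnS.
    by move=> ex; case/eqP: ne; apply: val_inj.
  apply: (@roots_geq_poly_eq0 _ _ [seq q ^- n | n <- iota 0 Nt.+1]).
  - apply/allP => x /mapP [n]; rewrite mem_iota => /andP [_ ltn] ->; apply/rootP.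
    by have [->//|/eqP nx] := eqVneq n x0; apply: off.
  - rewrite map_inj_uniq ?iota_uniq // => m n /invr_inj; exact: qX_inj.
  - by rewrite size_map size_iota.
pose c j := \sum_(e <- eps | i%:Z + e == j%:Z) D e.
have fc : f = \sum_(j < Nt.+1) c j *: qKpoly q at' Nt j.
  rewrite /f /c; under [RHS]eq_bigr => j _ do rewrite scaler_suml big_mkcond.
  rewrite [RHS]exchange_big /= big_mkcond; apply: eq_bigr => e _; case: ifP => hr.
    have lj : (`|(i%:Z + e)%R| < Nt.+1)%N by move: hr; rewrite /in_range; lia.
    rewrite (bigD1 (Ordinal lj)) //= ifT; last by move: hr; rewrite /in_range; lia.
    rewrite big1 ?addr0 // => j nj; rewrite ifF //; apply/negP => ej; case/eqP: nj.
    by apply: val_inj => /=; lia.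
  rewrite big1 // => j _; rewrite ifF //; apply/negP => ej; case/negP: (negbT hr).
  by rewrite /in_range; have := ltn_ord j; lia.
have szR k : (k < Nt.+1)%N -> size (qKpoly q at' Nt k) = k.+1 by move=> ?;
  apply: (size_qKpoly hq hat); lia.
have := @graded_basis_free _ _ _ szR c; rewrite -fc f0 => /(_ erefl `|(i%:Z + e0)%R|%N).
have -> : c `|(i%:Z + e0)%R|%N = D e0.
  rewrite /c (eq_bigl (pred1 e0)) => [|e]; last by rewrite /=; move: ir; rewrite /in_range; lia.
  by rewrite -big_filter filter_pred1_uniq // big_seq1.
move=> h; apply/eqP; rewrite -subr_eq0; apply/eqP/h.
by move: ir; rewrite /in_range; lia.
Qed.

Lemma B2_lam_poly lam Phi : (20 <= N)%N -> (20 <= Nt)%N ->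
  expansion q rho rhot eta [:: 1; 0; -1] lam Phi ->
  exists lamP : {poly F}, [/\ (size lamP <= 2)%N, forall z, z != 0 -> lam z = lamP.[z] &
    forall i, (1 < i <= 10)%N -> Lt (fun z => lamP.[z] * (qKpoly q a N i).[z]) = 0].
Proof.
move=> N20 Nt20 h.
have [lamP [slam elam]] : exists lamP : {poly F}, (size lamP <= 2)%N /\ forall z,
  z != 0 -> lam z = lamP.[z].
  exists (Phi 1 0%N *: (qKpoly q at' Nt 1 \Po (Y *: 'X)) + (Phi 0 0%N)%:P); split.
    apply: size_add_le; last by rewrite (leq_trans (size_polyC_leq1 _)).
    by rewrite (leq_trans (size_scale_leq _ _)) // size_dilate // (size_qKpoly hq hat) //; lia.
  move=> z z0; have [_ e1] := (expansionP _ _ _ _ _ _ _).1 h 0%N isT.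
  have := e1 z z0; rewrite (qKrawtchouk0 hq) mulr1 => ->; last first.
    by left=> e; rewrite !inE => /or3P [] /eqP -> /=; lia.
  rewrite !big_cons big_nil hornerD hornerZ hornerC horner_dilate (qKpolyE hq).
  rewrite -[0%:Z + 1]/1%:Z -[0%:Z + 0]/0%:Z !qKext_nat //=; last by lia.
  by rewrite qKext_out // (qKrawtchouk0 hq) mulr1 !mulr0 !addr0.
exists lamP; split=> // i hi.
rewrite -[RHS](@expansion_orthogonal _ _ _ i h); [|lia|].
  apply: eq_bigr => x _; rewrite elam ?(qKpolyE hq) //.
  by rewrite mulf_neq0 // exprnN.
by move=> e; rewrite !inE => /or3P [] /eqP ->; lia.
Qed.

Lemma B2'_lam_const lam Phi : (20 <= N)%N -> (20 <= Nt)%N ->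
  expansion q rho rhot eta [:: 0; -1; -2] lam Phi ->
  (forall z, z != 0 -> lam z = Phi 0 0%N) /\
    forall i, (2 < i <= 10)%N -> Lt (fun z => (Phi 0 0%N)%:P.[z] * (qKpoly q a N i).[z]) = 0.
Proof.
move=> N20 Nt20 h.
have elam z : z != 0 -> lam z = Phi 0 0%N.
  move=> z0; have [_ e1] := (expansionP _ _ _ _ _ _ _).1 h 0%N isT.
  have := e1 z z0; rewrite (qKrawtchouk0 hq) mulr1 => ->; last first.
    by left=> e; rewrite !inE => /or3P [] /eqP -> /=; lia.
  rewrite !big_cons big_nil -[0%:Z + 0]/0%:Z qKext_nat //.
  by rewrite !qKext_out // (qKrawtchouk0 hq) mulr1 !mulr0 !addr0.
split=> // i hi.
rewrite -[RHS](@expansion_orthogonal _ _ _ i h); [|lia|].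
  apply: eq_bigr => x _; rewrite elam ?hornerC ?(qKpolyE hq) //.
  by rewrite mulf_neq0 // exprnN.
by move=> e; rewrite !inE => /or3P [] /eqP ->; lia.
Qed.

End Pair.

End Expansions.

(** * Composed relations *)
Section Composition.
Variables (F : fieldType) (q : F).
Hypothesis hq : generic_base q.
Let q0 := q_neq0 hq.
Let qz0 (m : int) : q ^ m != 0 := qXz_neq0 hq m.

(** Coefficients of a contiguity relation P followed by an associated relation M. *)
Definition comp_up_down (P M : int -> nat -> F) (e : int) (i : nat) : F :=
  if e == 1 then P 0 i * M 1 i
  else if e == 0 then P 0 i * M 0 i + P (-1) i * M 1 i.-1
  else P (-1) i * M 0 i.-1.

(** Coefficients of a contiguity relation P followed by a contiguity relation M. *)
Definition comp_up_up (P M : int -> nat -> F) (e : int) (i : nat) : F :=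
  if e == 0 then P 0 i * M 0 i
  else if e == -1 then P 0 i * M (-1) i + P (-1) i * M 0 i.-1
  else P (-1) i * M (-1) i.-1.

Variables (rho rhob rhot : qKparam F).

(** The hypothesis on the grids is needed for the indices at which a term is omitted:
    the intermediate variable must then be in the intermediate grid. *)
Lemma expansion_comp_up_down e1 e2 l P M :
  (qK_N rhot <= (qK_N rhob).+1)%N ->
  (forall z, on_grid q (qK_N rho) z -> on_grid q (qK_N rhot) (q ^ (- (e1 - e2)) * z) ->
     on_grid q (qK_N rhob) (q ^ (- e1) * z)) ->
  expansion q rho rhob e1 [:: 0; -1] (fun _ => 1) P ->
  expansion q rhob rhot (- e2) [:: 1; 0] (fun zb => l (q ^ e2 * zb)) M ->
  expansion q rho rhot (e1 - e2) [:: 1; 0;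
    -1] (fun z => l (q ^ (- (e1 - e2)) * z)) (comp_up_down P M).
Proof.
move=> hN hgrid /(@expansionP F q) h1 /(@expansionP F q) h2; apply/(@expansionP F q) => i lei.
have [z1 i1] := h1 i lei.
have Pi : (qK_N rhob < i)%N -> P 0 i = 0.
  by move=> lt; apply: z1; rewrite ?inE ?eqxx // /in_range; lia.
have Pi1 : (i == 0%N) || (qK_N rhob < i.-1)%N -> P (-1) i = 0.
  by move=> lt; apply: z1; rewrite ?inE ?eqxx // /in_range; lia.
have Mi e j : e \in [:: 1; 0] -> (j <= qK_N rhob)%N -> (qK_N rhot)%:Z < j%:Z + e -> M e j = 0.
  by move=> ee lj lt; apply: (h2 j lj).1 => //; rewrite /in_range; lia.
split=> [e|z z0 hz].
  rewrite !inE => /or3P [] /eqP ->; rewrite /in_range /comp_up_down /= => hi.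
  - have [le|lt] := leqP i (qK_N rhob); last by rewrite Pi ?mul0r.
    by rewrite Mi ?mulr0 // ?inE //; lia.
  - rewrite [X in X + _](_ : _ = 0) ?add0r.
      have [le|lt] := leqP i.-1 (qK_N rhob); last by rewrite Pi1 ?mul0r // lt orbT.
      by rewrite Mi ?mulr0 // ?inE //; lia.
    have [le|lt] := leqP i (qK_N rhob); last by rewrite Pi ?mul0r.
    by rewrite Mi ?mulr0 // ?inE //; lia.
  - have [i0|i0] := eqVneq i 0%N; first by rewrite Pi1 ?i0 ?mul0r.
    have [le|lt] := leqP i.-1 (qK_N rhob); last by rewrite Pi1 ?mul0r // lt orbT.
    by rewrite Mi ?mulr0 // ?inE //; lia.
set zt := q ^ (- (e1 - e2)) * z; set zb := q ^ (- e1) * z.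
have zb0 : zb != 0 by rewrite mulf_neq0.
have ezt : q ^ e2 * zb = zt by rewrite /zt /zb mulrA -expfzDr // opprB.
have dom1 : expansion_domain q rho rhob e1 [:: 0; -1] i z.
  case: hz => [hz|[g1 g2]]; last by right; split=> //; exact: hgrid.
  by left=> e; have := hz 1 (mem_head _ _); rewrite !inE => h /orP [] /eqP ->; lia.
have dom2 j : (j <= i)%N -> expansion_domain q rhob rhot (- e2) [:: 1; 0] j zb.
  move=> lej; case: hz => [hz|[g1 g2]]; last first.
    by right; split; [exact: hgrid | rewrite opprK ezt].
  by left=> e; have := hz 1 (mem_head _ _); rewrite !inE => h /orP [] /eqP ->; lia.
have key j : (j <= i)%N -> (j <= qK_N rhob)%N -> l zt * qKext q rhob j zb =
    M 1 j * qKext q rhot (j%:Z + 1) zt + M 0 j * qKext q rhot j zt.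
  move=> lej leb; have [_ i2] := h2 j leb; rewrite qKext_nat //.
  have := i2 zb zb0 (dom2 j lej); rewrite ezt => ->.
  by rewrite !big_cons big_nil !addr0 opprK ezt.
have := i1 z z0 dom1; rewrite mul1r !big_cons !big_nil !addr0 -/zb => ->.
rewrite mulrDr !(mulrCA (l zt)) /comp_up_down /=.
transitivity (P 0 i * (M 1 i * qKext q rhot (i%:Z + 1) zt + M 0 i * qKext q rhot i zt)
  + P (-1) i * (M 1 i.-1 * qKext q rhot i zt + M 0 i.-1 * qKext q rhot (i%:Z - 1) zt));
    last by ring.
congr (_ + _).
  by have [le|lt] := leqP i (qK_N rhob); [rewrite key | rewrite Pi // !mul0r].
have [i0|i0] := eqVneq i 0%N; first by rewrite Pi1 ?i0 ?mul0r.
have [le|lt] := leqP i.-1 (qK_N rhob); last by rewrite Pi1 ?mul0r // lt orbT.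
have -> : i%:Z - 1 = i.-1%:Z by lia.
rewrite key //; last exact: leq_pred.
by have -> : i.-1%:Z + 1 = i%:Z by lia.
Qed.

Lemma expansion_comp_up_up e1 e2 P M :
  (qK_N rhot <= qK_N rhob)%N ->
  (forall z, on_grid q (qK_N rhot) (q ^ (- (e1 + e2)) * z) -> on_grid q (qK_N rhob) (q ^ (- e1) *
    z)) ->
  expansion q rho rhob e1 [:: 0; -1] (fun _ => 1) P ->
  expansion q rhob rhot e2 [:: 0; -1] (fun _ => 1) M ->
  expansion q rho rhot (e1 + e2) [:: 0; -1; -2] (fun z => 1) (comp_up_up P M).
Proof.
move=> hN hgrid /(@expansionP F q) h1 /(@expansionP F q) h2; apply/(@expansionP F q) => i lei.
have [z1 i1] := h1 i lei.
have Pi : (qK_N rhob < i)%N -> P 0 i = 0.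
  by move=> lt; apply: z1; rewrite ?inE ?eqxx // /in_range; lia.
have Pi1 : (i == 0%N) || (qK_N rhob < i.-1)%N -> P (-1) i = 0.
  by move=> lt; apply: z1; rewrite ?inE ?eqxx // /in_range; lia.
have Mi e j : e \in [:: 0; -1] -> (j <= qK_N rhob)%N -> ~~ in_range (qK_N rhot) (j%:Z + e) -> M e
  j = 0.
  by move=> ee lj; apply: (h2 j lj).1.
split=> [e|z z0 hz].
  have T0 e' : e' \in [:: 0; -1] -> ~~ in_range (qK_N rhot) (i%:Z + e') -> P 0 i * M e' i = 0.
    move=> ee hi; have [le|lt] := leqP i (qK_N rhob); last by rewrite Pi ?mul0r.
    by rewrite Mi ?mulr0.
  have T1 e' : e' \in [:: 0; -1] -> ~~ in_range (qK_N rhot) (i%:Z - 1 + e') -> P (-1) i * M e'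
    i.-1 = 0.
    move=> ee hi; have [i0|i0] := eqVneq i 0%N; first by rewrite Pi1 ?i0 ?mul0r.
    have [le|lt] := leqP i.-1 (qK_N rhob); last by rewrite Pi1 ?mul0r // lt orbT.
    by rewrite Mi ?mulr0 //; have -> : i.-1%:Z + e' = i%:Z - 1 + e' by lia.
  rewrite !inE => /or3P [] /eqP -> hi; rewrite /comp_up_up /=.
  - by rewrite T0.
  - by rewrite T0 // T1 ?addr0.
  - by rewrite T1 // -addrA.
set zt := q ^ (- (e1 + e2)) * z; set zb := q ^ (- e1) * z.
have zb0 : zb != 0 by rewrite mulf_neq0.
have ezt : q ^ (- e2) * zb = zt by rewrite /zt /zb mulrA -expfzDr // opprD addrC.
have dom1 : expansion_domain q rho rhob e1 [:: 0; -1] i z.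
  case: hz => [hz|[g1 g2]]; last by right; split=> //; exact: hgrid.
  by left=> e; have := hz 0 (mem_head _ _); rewrite !inE => h /orP [] /eqP ->; lia.
have dom2 j : (j <= i)%N -> expansion_domain q rhob rhot e2 [:: 0; -1] j zb.
  move=> lej; case: hz => [hz|[g1 g2]]; last first.
    by right; split; [exact: hgrid | rewrite ezt].
  by left=> e; have := hz 0 (mem_head _ _); rewrite !inE => h /orP [] /eqP ->; lia.
have key j : (j <= i)%N -> (j <= qK_N rhob)%N -> qKext q rhob j zb =
    M 0 j * qKext q rhot j zt + M (-1) j * qKext q rhot (j%:Z - 1) zt.
  move=> lej leb; have [_ i2] := h2 j leb; rewrite qKext_nat //.
  have := i2 zb zb0 (dom2 j lej); rewrite mul1r => ->.
  by rewrite !big_cons big_nil !addr0 ezt.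
have := i1 z z0 dom1; rewrite !big_cons !big_nil !addr0 -/zb => ->.
rewrite /comp_up_up /=.
transitivity (P 0 i * (M 0 i * qKext q rhot i zt + M (-1) i * qKext q rhot (i%:Z - 1) zt)
  + P (-1) i * (M 0 i.-1 * qKext q rhot (i%:Z - 1) zt + M (-1) i.-1 * qKext q rhot (i%:Z - 2)
    zt)); last by ring.
congr (_ + _).
  by have [le|lt] := leqP i (qK_N rhob); [rewrite key | rewrite Pi // !mul0r].
have [i0|i0] := eqVneq i 0%N; first by rewrite Pi1 ?i0 ?mul0r.
have [le|lt] := leqP i.-1 (qK_N rhob); last by rewrite Pi1 ?mul0r // lt orbT.
have -> : i%:Z - 1 = i.-1%:Z by lia.
rewrite key //; last exact: leq_pred.
by have -> : i.-1%:Z - 1 = i%:Z - 2 by lia.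
Qed.

End Composition.

Section Main.
Variables (F : fieldType) (q : F).
Hypothesis hq : generic_base q.
Let q0 := q_neq0 hq.
Let qz0 (m : int) : q ^ m != 0 := qXz_neq0 hq m.

Lemma oqK_shift o : A2_shift (oqK_eta o).
Proof. by case: o => [[]|]. Qed.

Lemma oqK_alpha o (rho : qKparam F) : qK_alpha (oqK_bar q o rho) = q ^+ isSome o * qK_alpha rho.
Proof. by case: o rho => [[]|] [a N] /=; rewrite ?expr1 ?expr0 ?mul1r. Qed.

Lemma oqK_generic o rho : generic_param q rho -> generic_param q (oqK_bar q o rho).
Proof.
move=> [a0 ha]; split; rewrite oqK_alpha; first by rewrite mulf_neq0 ?(qX_neq0 hq).
move=> m; apply: contra (ha (m - (isSome o)%:Z)) => /eqP e.
by rewrite expfzDr // -exprnN -e mulrAC mulfV ?mul1r ?(qX_neq0 hq).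
Qed.

Lemma grid_shift (N N' : nat) (e : int) (n : int) :
  on_grid q N (q ^ (- n)) /\ on_grid q N' (q ^ (- e) * q ^ (- n)) <-> (0 <= n <= N%:Z) /\ (0 <= n
    + e <= N'%:Z).
Proof.
rewrite -expfzDr //; have -> : - e - n = - (n + e) by lia.
by rewrite !(on_gridP hq).
Qed.

Section Pair.
Variables (rho rhot : qKparam F) (o1 o2 : option qK_case).
Hypothesis (ha : generic_param q rho) (hat : generic_param q rhot).
Hypothesis (N20 : (20 <= qK_N rho)%N) (Nt20 : (20 <= qK_N rhot)%N).

Let low o (N : nat) : (20 <= N)%N -> (lowers o <= N)%N.
Proof. by case: o => [[]|] //=; lia. Qed.

(** The relation composed of the contiguity relation o1 from rho and of the
    associated relation o2 back to rhot. *)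
Definition comp_Phi := comp_up_down (oqK_Phip q o1 rho) (oqK_Phim q o2 rhot).
Definition comp_lam (z : F) := oqK_lamm q o2 rhot (q ^ (- (oqK_eta o1 - oqK_eta o2)) * z).

Hypothesis bar_eq : oqK_bar q o1 rho = oqK_bar q o2 rhot.
Hypothesis o12 : o1 <> o2 \/ ~~ lowers o1.

Let Nbar : (qK_N rho - lowers o1 = qK_N rhot - lowers o2)%N.
Proof. by rewrite -!(oqK_barN q) bar_eq. Qed.

(** Composing qKII or qKIII with its own associated relation is excluded: its
    intermediate grid lacks a point that is common to the two outer grids. *)
Lemma comp_expansion :
  expansion q rho rhot (oqK_eta o1 - oqK_eta o2) [:: 1; 0; -1] comp_lam comp_Phi.
Proof.
apply: (expansion_comp_up_down hq (rhob := oqK_bar q o1 rho)).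
- by rewrite oqK_barN; move: Nbar; case: (lowers o2); lia.
- move=> z [n len ->]; rewrite [q ^- n]exprnN -!expfzDr // => hz.
  have := hz; have -> : - (oqK_eta o1 - oqK_eta o2) + - n%:Z =
    - (n%:Z + (oqK_eta o1 - oqK_eta o2)) by lia.
  move/(on_gridP hq) => h.
  have -> : - oqK_eta o1 + - n%:Z = - (n%:Z + oqK_eta o1) by lia.
  apply/(on_gridP hq); rewrite oqK_barN.
  move: Nbar o12 h; case: o1 => [[]|]; case: o2 => [[]|] /=; rewrite ?oppr0 => e [] // h; lia.
- by apply: (oqK_contiguity hq ha (low _ N20)).1.
- by rewrite bar_eq; apply: (oqK_associated hq hat (low _ Nt20)).
Qed.

Lemma comp_unique eps lam Phi Phi' : uniq eps -> (forall e : int, e \in eps -> -2 <= e <= 1) ->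
  expansion q rho rhot (oqK_eta o1 - oqK_eta o2) eps lam Phi ->
  expansion q rho rhot (oqK_eta o1 - oqK_eta o2) eps lam Phi' ->
  forall e i, e \in eps -> (i <= qK_N rho)%N -> Phi e i = Phi' e i.
Proof.
move=> ue be; move: ha hat N20 Nt20 Nbar; case: rho => a N;
  case: rhot => at' Nt /= ha' hat' h20 ht20 hN.
(* A case qKII for o2 adds the last point to the grid of rhot, a case qKIII the first. *)
pose x0 := if o2 is Some qKII then Nt else 0%N.
apply: (expansion_unique hq hat' (x0 := x0)) => //; first by lia.
  by rewrite /x0; case: o2 => [[]|].
move=> n len; rewrite /x0; move: hN o12; case: o1 => [[]|]; case: o2 => [[]|] /=; lia.
Qed.

Lemma comp_B2_from_A2 eta (k : F) lam Phi : k != 0 -> eta = oqK_eta o1 - oqK_eta o2 ->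
  (forall z, z != 0 -> lam z = k * comp_lam z) ->
  (forall e i, e \in [:: 1; 0; -1] -> (i <= qK_N rho)%N -> Phi e i = k * comp_Phi e i) ->
  B2_from_A2 q eta rho rhot lam Phi.
Proof.
move=> k0 -> hlam hPhi.
exists (oqK_eta o1), (oqK_eta o2), (oqK_bar q o1 rho), (fun _ => k * 1), (fun _ => 1),
  (oqK_lamm q o2 rhot),
  (fun e i => k * oqK_Phip q o1 rho e i), (oqK_Phip q o2 rhot), (oqK_Phim q o2 rhot).
have [A1 A1'] := oqK_contiguity hq ha (low o1 N20).
split; first by split; rewrite ?oqK_shift //; exact: oqK_generic.
split.
  split.
  - by split; [exact: expansion_scale | rewrite mulf_neq0].
  - by rewrite bar_eq; exact: oqK_contiguity (low _ Nt20).
  - by rewrite bar_eq; exact: oqK_associated (low _ Nt20).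
split=> [z z0|i lei]; first by rewrite hlam // mulr1.
by split; rewrite hPhi ?inE //= /comp_Phi /comp_up_down /=; ring.
Qed.

End Pair.

Section UpUp.
Variables (rho : qKparam F) (o1 o2 : option qK_case).
Hypothesis ha : generic_param q rho.
Hypothesis N22 : (22 <= qK_N rho)%N.

Let rhob := oqK_bar q o1 rho.
Let rhot := oqK_bar q o2 rhob.
Let eta := oqK_eta o1 + oqK_eta o2.
Let hb : generic_param q rhob. Proof. exact: oqK_generic. Qed.
Let ht : generic_param q rhot. Proof. exact: oqK_generic. Qed.
Let Nb : qK_N rhob = (qK_N rho - lowers o1)%N. Proof. exact: oqK_barN. Qed.
Let Nt : qK_N rhot = (qK_N rho - lowers o1 - lowers o2)%N. Proof. by rewrite oqK_barN Nb. Qed.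
Let low1 : (lowers o1 <= qK_N rho)%N. Proof. by case: (lowers o1); lia. Qed.
Let low2 : (lowers o2 <= qK_N rhob)%N. Proof. by rewrite Nb; case: (lowers o1);
  case: (lowers o2); lia. Qed.

(** The relation composed of the contiguity relations o1 and o2. *)
Definition comp2_Phi := comp_up_up (oqK_Phip q o1 rho) (oqK_Phip q o2 rhob).

Lemma comp2_expansion : expansion q rho rhot eta [:: 0; -1; -2] (fun _ => 1) comp2_Phi.
Proof.
apply: (expansion_comp_up_up hq (rhob := rhob)).
- by rewrite Nt Nb; lia.
- move=> z [n len e].
  have -> : q ^ (- oqK_eta o1) * z = q ^ (- (n%:Z - oqK_eta o2)).
    have -> : - (n%:Z - oqK_eta o2) = oqK_eta o2 + - n%:Z by lia.
    by rewrite expfzDr // -exprnN -e mulrA -expfzDr // opprD addrCA subrr addr0.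
  apply/(on_gridP hq); move: len; rewrite Nt Nb.
  by move: N22; case: o1 => [[]|]; case: o2 => [[]|] /=; lia.
- by apply: (oqK_contiguity hq ha low1).1.
- by apply: (oqK_contiguity hq hb low2).1.
Qed.

Lemma comp2_B2'_from_A2 (k : F) lam Phi : k != 0 -> (forall z, z != 0 -> lam z = k) ->
  expansion q rho rhot eta [:: 0; -1; -2] lam Phi -> B2'_from_A2 q eta rho rhot lam Phi.
Proof.
move=> k0 hlam h.
have hPhi e i : e \in [:: 0; -1; -2] -> (i <= qK_N rho)%N -> Phi e i = k * comp2_Phi e i.
  have := comp2_expansion => /(expansion_scale k) /(expansion_eq_lam (lam' := lam)) => hc.
  have {hc} := hc (fun z z0 => etrans (mulr1 k) (esym (hlam z z0))); move: e i h.
  move: Nt ht; case: (rhot) => at' M /= eM ht'; move: N22 eM;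
    case: (rho) => a N /= N22' eM e i h hc.
  apply: (expansion_unique hq ht' (x0 := 0%N) _ _ _ _ _ h hc) => //.
  - by move=> e'; rewrite !inE => /or3P [] /eqP ->.
  - by move: eM; case: (lowers o1); case: (lowers o2); lia.
  - by move=> n len _; move: len eM N22'; rewrite /eta; case: o1 => [[]|]; case: o2 => [[]|] /=;
    lia.
exists (oqK_eta o1), (oqK_eta o2), rhob, (fun _ => k * 1), (fun _ => 1),
  (fun e i => k * oqK_Phip q o1 rho e i), (oqK_Phip q o2 rhob).
have [A1 A1'] := oqK_contiguity hq ha low1.
split; first by split; rewrite ?oqK_shift.
split.
  split; last exact: oqK_contiguity low2.
  by split; [exact: expansion_scale | rewrite mulf_neq0].
split=> [z z0|i lei]; first by rewrite hlam // !mulr1.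
by split; rewrite hPhi ?inE //= /comp2_Phi /comp_up_up /=; ring.
Qed.

End UpUp.

Lemma horner_nz_neq0 (lam : F -> F) (lamP : {poly F}) :
  (forall z, z != 0 -> lam z = lamP.[z]) -> (exists2 z, z != 0 & lam z != 0) -> lamP != 0.
Proof. by move=> e [z z0]; rewrite e //; apply: contraNneq => ->; rewrite horner0. Qed.

(** [B2_classify] applied to an expansion. *)
Lemma B2_lam_classify rho rhot eta lam Phi :
  generic_param q rho -> generic_param q rhot -> (20 <= qK_N rho)%N -> (20 <= qK_N rhot)%N ->
  expansion q rho rhot eta [:: 1; 0; -1] lam Phi -> (exists2 z, z != 0 & lam z != 0) ->
  (eta = 0 /\ rhot = rho) \/
  exists o1 o2, [/\ o1 <> o2, eta = oqK_eta o1 - oqK_eta o2,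
    oqK_bar q o1 rho = oqK_bar q o2 rhot &
    exists2 k, k != 0 & forall z, z != 0 -> lam z = k * oqK_lamm q o2 rhot (q ^ (- eta) * z)].
Proof.
case: rho rhot => [a N] [at' Nt] ha hat /= N20 Nt20 h hnz.
have [lamP [sl el hl]] := B2_lam_poly hq hat N20 Nt20 h.
have lam0 := horner_nz_neq0 el hnz.
have [|[o1 [o2 [h1 h2 h3 [k k0 hk]]]]] := B2_classify hq ha hat N20 Nt20 lam0 sl hl; first by left.
by right; exists o1, o2; split=> //; exists k => // z z0; rewrite el.
Qed.

Lemma B2_nontrivial_composed rho rhot eta lam Phi :
  generic_param q rho -> generic_param q rhot -> (20 <= qK_N rho)%N -> (20 <= qK_N rhot)%N ->
  B2_contiguity q eta rho rhot lam Phi -> ~ (eta = 0 /\ rhot = rho) ->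
  B2_from_A2 q eta rho rhot lam Phi.
Proof.
move=> ha hat N20 Nt20 [h hnz] nt.
have [//|[o1 [o2 [h1 h2 h3 [k k0 hk]]]]] := B2_lam_classify ha hat N20 Nt20 h hnz.
have o12 : o1 <> o2 \/ ~~ lowers o1 by left.
subst eta.
apply: (comp_B2_from_A2 ha hat N20 Nt20 h3 k0 erefl hk).
have hc := expansion_scale k (comp_expansion ha hat N20 Nt20 h3 o12).
apply: (comp_unique ha hat N20 Nt20 h3 o12 _ _ h) => //.
  by move=> e; rewrite !inE => /or3P [] /eqP ->.
by apply: expansion_eq_lam hc => z z0; rewrite hk.
Qed.

(** For the trivial parameters the multiplier is any polynomial of degree at most 1;
    the composition of qKI with its associated relation has multiplier q^N z, and the
    trivial relation has multiplier 1. *)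
Lemma B2_trivial_span rho lam Phi :
  generic_param q rho -> (20 <= qK_N rho)%N ->
  expansion q rho rho 0 [:: 1; 0; -1] lam Phi ->
  exists (k1 k2 : F) (lam1 lam2 : F -> F) (Phi1 Phi2 : int -> nat -> F),
    [/\ B2_from_A2 q 0 rho rho lam1 Phi1, B2_from_A2 q 0 rho rho lam2 Phi2 &
      same_relation (qK_N rho) [:: 1; 0; -1]
        lam (fun z => k1 * lam1 z + k2 * lam2 z) Phi (fun e i => k1 * Phi1 e i + k2 * Phi2 e i)].
Proof.
move=> ha N20 h; pose I := Some qKI.
have lI : I <> I \/ ~~ lowers I by right.
have lT : None <> None :> option qK_case \/ ~~ lowers None by right.
have [c0 [c1 elam]] : exists c0 c1, forall z, z != 0 -> lam z = c0 + c1 * z.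
  case: rho ha N20 h => a N ha /= N20 h; have [lamP [sl el _]] := B2_lam_poly hq ha N20 N20 h.
  by exists lamP`_0, lamP`_1 => z z0; rewrite el // horner_size2.
have qN0 := qX_neq0 hq (qK_N rho).
exists (c1 / q ^+ qK_N rho), c0, (comp_lam rho I I), (comp_lam rho None None),
  (comp_Phi rho rho I I), (comp_Phi rho rho None None).
have e1 := comp_expansion ha ha N20 N20 (erefl (oqK_bar q I rho)) lI.
have e2 := comp_expansion ha ha N20 N20 (erefl (oqK_bar q None rho)) lT.
have el z : z != 0 -> c1 / q ^+ qK_N rho * comp_lam rho I I z + c0 * comp_lam rho None None z =
  lam z.
  by move=> z0; rewrite elam // /comp_lam /= subr0 oppr0 expr0z mul1r mulr1 addrC;
    case: (rho) qN0 => a N /= qN0; rewrite mulrA divfK.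
split.
- apply: (comp_B2_from_A2 (o1 := I) (o2 := I) ha ha N20 N20 erefl (oner_neq0 F)) => //.
    by move=> z _; rewrite mul1r.
  by move=> e i _ _; rewrite mul1r.
- apply: (comp_B2_from_A2 (o1 := None) (o2 := None) ha ha N20 N20 erefl (oner_neq0 F)) => //.
    by move=> z _; rewrite mul1r.
  by move=> e i _ _; rewrite mul1r.
split=> [z z0|e i]; first by rewrite el.
have ec := expansion_eq_lam el (expansion_lin (c1 / q ^+ qK_N rho) c0 e1 e2).
apply: (comp_unique (o1 := I) (o2 := I) ha ha N20 N20 erefl lI _ _ h ec) => //.
by move=> e'; rewrite !inE => /or3P [] /eqP ->.
Qed.

Lemma B2'_composed rho rhot eta lam Phi :
  generic_param q rho -> generic_param q rhot -> (22 <= qK_N rho)%N -> (20 <= qK_N rhot)%N ->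
  B2'_contiguity q eta rho rhot lam Phi -> B2'_from_A2 q eta rho rhot lam Phi.
Proof.
move=> ha hat N22 Nt20 [h [z1 z10 hnz]].
have [k k0 [elam [o1 [o2 [e1 e2]]]]] : exists2 k, k != 0 & (forall z, z != 0 -> lam z = k) /\
    exists o1 o2, eta = oqK_eta o1 + oqK_eta o2 /\ rhot = oqK_bar q o2 (oqK_bar q o1 rho).
  case: rho rhot ha hat N22 Nt20 h => [a N] [at' Nt] ha hat /= N22 Nt20 h.
  have N20 : (20 <= N)%N by lia.
  have [el hl] := B2'_lam_const hq hat N20 Nt20 h.
  have k0 : Phi 0 0%N != 0 by rewrite -(el z1).
  by exists (Phi 0 0%N) => //; split=> //; apply: (B2'_classify hq ha hat N20 Nt20 k0 hl).
by subst eta rhot; apply: (comp2_B2'_from_A2 ha N22 k0 elam).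
Qed.

Lemma A2_multiplier rho rhob eta lamp Phip :
  expansion q rho rhob eta [:: 0; -1] lamp Phip ->
  forall z, z != 0 -> lamp z = Phip 0 0%N.
Proof.
move=> /(@expansionP F q) h z z0; have [_ e1] := h 0%N isT.
have := e1 z z0; rewrite (qKrawtchouk0 hq) mulr1 => ->; last first.
  by left=> e; rewrite !inE => /orP [] /eqP -> /=; lia.
rewrite !big_cons big_nil -[0%:Z + 0]/0%:Z qKext_nat //.
by rewrite qKext_out // (qKrawtchouk0 hq) mulr1 !mulr0 !addr0.
Qed.

(** In an A_2-contiguity relation N decreases by at most one.  Otherwise the sum for
    i = N is empty, so that R_N would vanish at a common point of the two grids with
    x = 0 or x = 1; but R_N is 1 at x = 0 and alpha q^N at x = 1. *)
Lemma A2_N_bound eta rho rhob lamp Phip :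
  generic_param q rho -> A2_shift eta -> (0 < qK_N rhob)%N -> (2 <= qK_N rho)%N ->
  A2_contiguity q eta rho rhob lamp Phip -> (qK_N rho <= (qK_N rhob).+1)%N.
Proof.
move=> ha sh Nb0 N2 [hA P0]; rewrite leqNgt; apply/negP => lt.
have h := (expansionP _ _ _ _ _ _ _).1 hA.
have lamE := A2_multiplier hA.
have vanish (n : int) : 0 <= n <= (qK_N rho)%:Z -> 0 <= n + eta <= (qK_N rhob)%:Z ->
    qKrawtchouk q rho (qK_N rho) (q ^ (- n)) = 0.
  move=> h1 h2; have [_ e1] := h (qK_N rho) (leqnn _).
  have := e1 _ (qz0 (- n)); rewrite lamE // => /(_ (or_intror ((grid_shift _ _ _ _).2 (conj h1
    h2)))).
  rewrite !big_cons big_nil !qKext_out /in_range; [|lia|lia].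
  by rewrite !mulr0 !addr0 => /eqP; rewrite mulf_eq0 (negbTE P0) => /eqP.
have at1 : qKrawtchouk q rho (qK_N rho) 1 = 1.
  case: (rho) => a N; rewrite (@qKrawtchoukE _ _ hq _ _ _ N.+1) // big_ord_recl qKcoef0 // qpoch0
    big1 ?mulr1 ?addr0 // => k _.
  by rewrite qpochSl subrr mul0r mulr0.
move: sh; rewrite /A2_shift !inE => /or3P [] /eqP ee.
- have v0 : qKrawtchouk q rho (qK_N rho) (q ^ (- 0)) = 0 by apply: vanish; lia.
  by move/eqP: v0; rewrite oppr0 expr0z at1 oner_eq0.
- have v0 : qKrawtchouk q rho (qK_N rho) (q ^ (- 0)) = 0 by apply: vanish; lia.
  by move/eqP: v0; rewrite oppr0 expr0z at1 oner_eq0.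
have : qKrawtchouk q rho (qK_N rho) (q ^ (- 1)) = 0 by apply: vanish; lia.
clear h hA lt vanish at1; case: rho ha N2 => a N ha /= N2.
rewrite (@qKrawtchoukE _ _ hq _ _ _ N.+1) //; case: N ha N2 => // N ha N2.
rewrite !big_ord_recl big1 => [|k _]; last first.
  have -> : q ^ (- 1) = q ^- 1 by [].
  by rewrite /bump /= (qpochqN_eq0 hq) ?mulr0.
rewrite /= /bump /= !qKcoef0 // qpoch0 /qKcoef /qKnum !qpochS !qpoch0 !expr0 expr1 exprN1 !mulr1
  !mul1r addr0.
have D1 := qX_neq1 hq (ltn0Sn 0); have D2 := qX_neq1 hq (ltn0Sn N); rewrite expr1 in D1.
have D3 : q ^+ N.+1 - 1 != 0 by rewrite -opprB oppr_eq0.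
move=> e; have : a * q ^+ N.+1 = 0.
  rewrite -[RHS]e; move: D1 D2 D3 (qX_neq0 hq N.+1) q0; move: (q ^+ N.+1) => w D1 D2 D3 D4 D5.
  by fld.
by move/eqP; rewrite mulf_eq0 (negbTE (qX_neq0 hq _)) orbF; case: ha => /negbTE /= ->.
Qed.

End Main.

(** * Relations of type A2 *)
Section A2.
Variables (F : fieldType) (q : F).
Hypothesis hq : generic_base q.
Let q0 := q_neq0 hq.
Let qz0 (m : int) : q ^ m != 0 := qXz_neq0 hq m.

(** Among the multipliers of associated relations only the trivial one is constant. *)
Lemma oqK_lamm_const o rho (k c : F) : (0 < qK_N rho)%N -> k != 0 ->
  (forall z, z != 0 -> k * oqK_lamm q o rho z = c) -> o = None.
Proof.
case: o rho => [o|] // [a N] /= N0 k0 h; exfalso.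
have q1 := qX_neq1 hq (ltn0Sn 0); rewrite expr1 in q1.
have D := qX_neq1 hq N0.
have := h q q0; rewrite -(h 1 (oner_neq0 F)) => /(mulfI k0)/eqP.
case: o {h} => /=; rewrite -subr_eq0; apply/negP.
- have -> : q ^+ N * q - q ^+ N * 1 = - (q ^+ N * (1 - q)) by ring.
  by rewrite oppr_eq0 mulf_neq0 ?(qX_neq0 hq).
- have -> : (1 - q ^+ N * q) / (1 - q ^+ N) - (1 - q ^+ N * 1) / (1 - q ^+ N) =
  q ^+ N * (1 - q) / (1 - q ^+ N) by field.
  by rewrite !mulf_neq0 ?invr_eq0 ?(qX_neq0 hq).
- by rewrite subrr mul0r subr0 mulf_neq0 ?invr_eq0.
Qed.

Lemma expansion_pad_B2 rho rhot eta (eps : seq int) lam Phi : uniq eps -> {subset eps <= [:: 1;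
  0; -1]} ->
  expansion q rho rhot eta eps lam Phi ->
  expansion q rho rhot eta [:: 1; 0; -1] lam (fun e i => if e \in eps then Phi e i else 0).
Proof. by move=> ue; exact: expansion_pad. Qed.

Lemma A2_classification rho rhob eta lamp Phip :
  generic_param q rho -> generic_param q rhob -> (20 <= qK_N rho)%N -> (20 <= qK_N rhob)%N ->
  ~ (eta = 0 /\ rhob = rho) -> A2_contiguity q eta rho rhob lamp Phip ->
  exists c, [/\ eta = qK_eta c, rhob = qK_bar q c rho &
    exists2 k, k != 0 & same_relation (qK_N rho) [:: 0; -1]
      lamp (fun _ => k) Phip (fun e i => k * qK_Phip q c rho e i)].
Proof.
move=> ha hb N20 Nb20 nt [h P0].
have lamE := A2_multiplier hq h.
have hpad : expansion q rho rhob eta [:: 1; 0; -1] lamp _ := expansion_pad_B2 (eps := [:: 0;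
  -1]) isT _ h.
have sub : {subset [:: 0; -1] <= [:: 1; 0; -1 : int]} by move=> e; rewrite !inE orbC => ->;
  rewrite ?orbT.
have hnz : exists2 z, z != 0 & lamp z != 0 by exists 1; rewrite ?oner_neq0 ?lamE ?oner_neq0.
have [//|[o1 [o2 [h1 h2 h3 [k k0 hk]]]]] := B2_lam_classify hq ha hb N20 Nb20 (hpad sub) hnz.
have o2N : o2 = None.
  apply: (@oqK_lamm_const o2 rhob k (Phip 0 0%N)) => // [|z z0]; first by lia.
  have := hk (q ^ eta * z); rewrite mulrA -expfzDr // addNr expr0z mul1r => <-;
    last by rewrite mulf_neq0.
  by rewrite lamE // mulf_neq0.
subst o2; case: o1 h1 h2 h3 => // c h1 h2 h3.
have lowc : (lowers (Some c) <= qK_N rho)%N by case: (c) => /=; lia.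
have [hc _] := oqK_contiguity hq ha lowc.
exists c; split; [by rewrite h2 subr0 | by rewrite -[rhob]/(oqK_bar q None rhob) -h3 |].
have k0' := P0; exists (Phip 0 0%N) => //; split => // e i.
have h3' : rhob = qK_bar q c rho by rewrite -[rhob]/(oqK_bar q None rhob) -h3.
have e12 : Some c <> None \/ ~~ lowers (Some c) by left.
apply: (comp_unique hq ha hb N20 Nb20 h3 e12 (eps := [:: 0;
  -1]) (lam := lamp) (Phi' := fun e i => Phip 0 0%N * qK_Phip q c rho e i)) => //.
- by move=> e'; rewrite !inE => /orP [] /eqP ->.
- by rewrite -h2.
rewrite h3' subr0; apply: expansion_eq_lam (expansion_scale (Phip 0 0%N) hc) => z z0.
by rewrite mulr1 lamE.
Qed.

Lemma B2_multiplier_poly rho rhot eta lam Phi :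
  generic_param q rhot -> (20 <= qK_N rho)%N -> (20 <= qK_N rhot)%N ->
  expansion q rho rhot eta [:: 1; 0; -1] lam Phi ->
  exists2 lamP : {poly F}, (size lamP <= 2)%N & forall z, z != 0 -> lam z = lamP.[z].
Proof.
case: rho rhot => [a N] [at' Nt] hat N20 Nt20 h.
by have [lamP [sl el _]] := B2_lam_poly hq hat N20 Nt20 h; exists lamP.
Qed.

(** The associated relation goes from the barred parameters back to rho; the
    classification of type B_2 in this direction only leaves the case c. *)
Lemma A2_associated_unique c rho lamm Phim :
  generic_param q rho -> (22 <= qK_N rho)%N ->
  A2_associated q (qK_eta c) rho (qK_bar q c rho) lamm Phim ->
  exists k : F, same_relation (qK_N (qK_bar q c rho)) [:: 1; 0]
    lamm (fun z => k * qK_lamm q c rho z) Phim (fun e i => k * qK_Phim q c rho e i).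
Proof.
move=> ha N22 h; set rhob := qK_bar q c rho; set eta := qK_eta c.
have hb : generic_param q rhob by exact: (oqK_generic hq (Some c)).
have lowc : (lowers (Some c) <= qK_N rho)%N by case: (c) => /=; lia.
have N20 : (20 <= qK_N rho)%N by lia.
have Nb20 : (20 <= qK_N rhob)%N.
  by have := oqK_barN q (Some c) rho; rewrite /rhob /= => ->; case: (c) => /=; lia.
have hc := oqK_associated hq ha lowc.
suff [k hk] : exists k, forall z, z != 0 -> lamm z = k * qK_lamm q c rho z.
  exists k; split=> // e i.
  have e3 : oqK_bar q None rhob = oqK_bar q (Some c) rho by [].
  have e12 : None <> Some c \/ ~~ lowers None by left.
  apply: (comp_unique hq hb ha Nb20 N20 e3 e12 (eps := [:: 1;
    0]) (lam := fun zb => lamm (q ^ eta * zb))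
    (Phi' := fun e i => k * qK_Phim q c rho e i)) => //.
  - by move=> e'; rewrite !inE => /orP [] /eqP ->.
  - by rewrite sub0r.
  rewrite sub0r; apply: expansion_eq_lam (expansion_scale k hc) => z z0.
  by rewrite hk // mulf_neq0.
have sub : {subset [:: 1; 0] <= [:: 1; 0; -1 : int]}.
  by move=> e; rewrite !inE => /orP [] ->; rewrite ?orbT.
have hpad := expansion_pad_B2 (eps := [:: 1; 0]) isT sub h.
case: (hb) => [b0 _]; case: (ha) => [a0 _].
have q1 : q != 1 by have := qX_neq1 hq (ltn0Sn 0); rewrite expr1 subr_eq0 eq_sym.
have alb : qK_alpha rhob = q * qK_alpha rho by rewrite -[rhob]/(oqK_bar q (Some c) rho) oqK_alpha
  expr1.
have [lamP elam] : exists lamP : {poly F}, forall z, z != 0 -> lamm (q ^ eta * z) = lamP.[z].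
  by have [lamP _ el] := B2_multiplier_poly ha Nb20 N20 hpad; exists lamP.
have lamE z : z != 0 -> lamm z = lamP.[q ^ (- eta) * z].
  move=> z0; rewrite -elam ?mulf_neq0 //.
  by rewrite mulrA -expfzDr // subrr expr0z mul1r.
have [lP0|lP0] := eqVneq lamP 0.
  by exists 0 => z z0; rewrite lamE // lP0 horner0 mul0r.
have hnz : exists2 z, z != 0 & lamm (q ^ eta * z) != 0.
  have [j _ nr] := far_nonroot hq 0 lP0; exists (q ^- j); first by rewrite invr_eq0 (qX_neq0 hq).
  by rewrite elam // invr_eq0 (qX_neq0 hq).
have [[_ erho]|[o1 [o2 [h1 h2 h3 [k k0 hk]]]]] := B2_lam_classify hq hb ha Nb20 N20 hpad hnz.
  move: alb; rewrite -erho => /eqP; rewrite -{1}[qK_alpha _]mul1r (inj_eq (mulIf a0)) eq_sym.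
  by rewrite (negbTE q1).
have /eqP := congr1 (@qK_alpha F) h3; rewrite !oqK_alpha alb mulrA -exprSr (inj_eq (mulIf a0)).
rewrite (inj_eq (qX_inj hq)) => /eqP e12.
have [eo1 [c' eo2]] : o1 = None /\ exists c', o2 = Some c'.
  by case: (o1) (o2) e12 => [?|] [c'|] //= _; split=> //; exists c'.
subst o1 o2.
have ecc : c' = c.
  have /(congr1 (@qK_N F)) := h3; rewrite /rhob; move: h2; rewrite /eta.
  by case: (rho) N20 => a N /= N20'; case: (c); case: (c') => //=; lia.
exists k => z z0; have := hk (q ^ (- eta) * z); rewrite opprK mulrA -expfzDr // addrN expr0z mul1r.
by rewrite ecc => ->; rewrite // mulf_neq0.
Qed.

End A2.

Theorem mainTheorem12 :
  (forall (F : fieldType) (q : F) (rho : qKparam F) (c : qK_case),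
     generic_base q -> generic_param q rho ->
     (c <> qKI -> (0 < qK_N rho)%N) ->
     A2_contiguity q (qK_eta c) rho (qK_bar q c rho)
       (fun _ => 1) (qK_Phip q c rho) /\
     A2_associated q (qK_eta c) rho (qK_bar q c rho)
       (qK_lamm q c rho) (qK_Phim q c rho))
  /\
  exists N0 : nat,
  forall (F : fieldType) (q : F) (rho : qKparam F),
    generic_base q -> generic_param q rho -> (N0 <= qK_N rho)%N ->
    (forall (eta : int) (rhob : qKparam F)
            (lamp : F -> F) (Phip : int -> nat -> F),
       A2_shift eta -> generic_param q rhob -> (0 < qK_N rhob)%N ->
       ~ (eta = 0 /\ rhob = rho) ->
       A2_contiguity q eta rho rhob lamp Phip ->
       exists c : qK_case,
         [/\ eta = qK_eta c,
             rhob = qK_bar q c rho,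
             (exists2 k : F, k != 0 &
                same_relation (qK_N rho) [:: 0; -1]
                  lamp (fun _ => k) Phip (fun e i => k * qK_Phip q c rho e i)) &
             (forall (lamm : F -> F) (Phim : int -> nat -> F),
                A2_associated q eta rho rhob lamm Phim ->
                exists k : F,
                  same_relation (qK_N rhob) [:: 1; 0]
                    lamm (fun z => k * qK_lamm q c rho z)
                    Phim (fun e i => k * qK_Phim q c rho e i))])
    /\
    (forall (eta : int) (rhot : qKparam F)
            (lam : F -> F) (Phi : int -> nat -> F),
       generic_param q rhot ->
       [\/ qK_N rhot = qK_N rho,
           (qK_N rhot).+1 = qK_N rho \/ qK_N rhot = (qK_N rho).+1 |
           (qK_N rhot).+2 = qK_N rho \/ qK_N rhot = (qK_N rho).+2] ->
       (B2_contiguity q eta rho rhot lam Phi ->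
          (~ (eta = 0 /\ rhot = rho) -> B2_from_A2 q eta rho rhot lam Phi) /\
          (eta = 0 /\ rhot = rho ->
             exists (k1 k2 : F) (lam1 lam2 : F -> F) (Phi1 Phi2 : int -> nat -> F),
               [/\ B2_from_A2 q eta rho rhot lam1 Phi1,
                   B2_from_A2 q eta rho rhot lam2 Phi2 &
                   same_relation (qK_N rho) [:: 1; 0; -1]
                     lam (fun z => k1 * lam1 z + k2 * lam2 z)
                     Phi (fun e i => k1 * Phi1 e i + k2 * Phi2 e i)])) /\
       (B2'_contiguity q eta rho rhot lam Phi ->
          B2'_from_A2 q eta rho rhot lam Phi)).
Proof.
split=> [F q rho c hq ha hN|].
  have low : (lowers (Some c) <= qK_N rho)%N by case: c hN => //= hN; exact: hN.
  by split; [exact: (oqK_contiguity hq ha low) | exact: (oqK_associated hq ha low)].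
(* The classification needs N and N' to be at least 20, and N' >= N - 2. *)
exists 22%N => F q rho hq ha N22; have N20 : (20 <= qK_N rho)%N by lia.
split=> [eta rhob lamp Phip sh hb Nb0 nt hA|eta rhot lam Phi hat Nt].
  have le2 : (2 <= qK_N rho)%N by lia.
  have Nb := A2_N_bound hq ha sh Nb0 le2 hA.
  have Nb20 : (20 <= qK_N rhob)%N by lia.
  have [c [-> -> hc]] := A2_classification hq ha hb N20 Nb20 nt hA.
  by exists c; split=> // lamm Phim; exact: A2_associated_unique.
have Nt20 : (20 <= qK_N rhot)%N by case: Nt => [|[]|[]]; lia.
split=> [hB|]; last exact: B2'_composed.
split=> [nt|[ee er]]; first exact: B2_nontrivial_composed hB nt.
by subst eta rhot; case: hB => hB _; exact: B2_trivial_span.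
Qed.
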